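(* Let $(X,\phi)$ be a calibrated manifold and suppose $A$ is a closed subset of a $\phi$-free submanifold $M$ of $X$. Then there exists a non-negative function $f\in C^\infty(X)$ with (a) $A=\{x\in X:f(x)=0\}$; (b) $f$ is strictly $\phi$-plurisubharmonic at each point in $M$ (and hence in a neighborhood of $M$ in $X$).
   Context: A calibrated manifold $(X,\phi)$ of degree $p\ge 1$ is a smooth riemannian manifold $X$ together with a closed smooth $p$-form $\phi$ such that $\phi(\xi)\le 1$ for every unit simple tangent $p$-vector $\xi$ on $X$. $G_x(\phi)$ denotes the set of unit simple $p$-vectors $\xi$ at $x$ with $\phi(\xi)=1$ ($\phi$-planes); each $\xi$ determines a $p$-dimensional subspace $\mathrm{span}\,\xi\subset T_xX$. For $f\in C^\infty(X)$, the $\phi$-Hessian of $f$ is the $p$-form $\mathcal H^\phi(f)(v_1,\dots,v_p)=\sum_{i=1}^p\phi(v_1,\dots,\nabla_{v_i}(\nabla f),\dots,v_p)$ ($\nabla_{v_i}(\nabla f)$ in the $i$-th slot, $\nabla$ the Levi-Civita connection). $f$ is strictly $\phi$-plurisubharmonic at $x$ if $\mathcal H^\phi(f)(\xi)>0$ for all $\xi\in G_x(\phi)$. A submanifold $M\subset X$ that is a closed subset (of any dimension) is $\phi$-free if there is no $x\in M$ and $\xi\in G_x(\phi)$ with $\mathrm{span}\,\xi\subset T_xM$. *)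

(* Defs.v *)
(* A tensor field on a manifold is given by its components in every chart of  *)
(* the maximal atlas, subject to the usual transformation law. Vectors are    *)
(* row vectors, so a tangent vector v in a chart c reads  v *m 'J tau y  in   *)
(* another chart, tau being the change of coordinates.                        *)
From HB Require Import structures.
From mathcomp Require Import all_boot all_order all_algebra.
From mathcomp Require Import all_classical all_reals all_analysis.
From mathcomp Require Import lra.
Set Implicit Arguments.
Unset Strict Implicit.
Unset Printing Implicit Defensive.
Import Order.TTheory GRing.Theory Num.Theory.
Import numFieldNormedType.Exports.
Local Open Scope classical_set_scope.
Local Open Scope ring_scope.

Section Smoothness.
Variables (R : realType) (n : nat).
Implicit Types (f : 'rV[R]_n -> R) (U : set 'rV[R]_n).

Definition pderiv (i : 'I_n) f : 'rV[R]_n -> R :=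
  fun y => 'D_(delta_mx 0 i) f y.

Definition iter_pderiv (s : seq 'I_n) f : 'rV[R]_n -> R := foldr pderiv f s.

(* C^oo on an open set U: every iterated partial derivative is (Frechet)      *)
(* differentiable at every point of U.                                        *)
Definition smooth_on U f : Prop :=
  forall (s : seq 'I_n) y, U y -> differentiable (iter_pderiv s f) y.

Definition smooth_map_on U (F : 'rV[R]_n -> 'rV[R]_n) : Prop :=
  forall j : 'I_n, smooth_on U (fun y => F y 0 j).

End Smoothness.

Section Manifold.
Variables (R : realType) (n : nat) (X : topologicalType).

(* coord and param are total functions, meaningful on dom and cod only. *)
Record chart := Chart {
  dom : set X;
  cod : set 'rV[R]_n;
  coord : X -> 'rV[R]_n;
  param : 'rV[R]_n -> X;
  dom_open : open dom;
  cod_open : open cod;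
  coord_cod : forall x, dom x -> cod (coord x);
  param_dom : forall y, cod y -> dom (param y);
  coordK : forall x, dom x -> param (coord x) = x;
  paramK : forall y, cod y -> coord (param y) = y;
  coord_continuous : forall x, dom x -> {for x, continuous coord};
  param_continuous : forall y, cod y -> {for y, continuous param} }.

Definition transition (c c' : chart) : 'rV[R]_n -> 'rV[R]_n :=
  fun y => coord c' (param c y).

Definition overlap (c c' : chart) : set 'rV[R]_n :=
  cod c `&` [set y | dom c' (param c y)].

Definition compatible (c c' : chart) : Prop :=
  smooth_map_on (overlap c c') (transition c c') /\
  smooth_map_on (overlap c' c) (transition c' c).

Record smooth_structure := SmoothStructure {
  atlas : set chart;
  manifold_hausdorff : hausdorff_space X;
  manifold_second_countable : @second_countable X;
  atlas_cover : forall x, exists2 c, atlas c & dom c x;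
  atlas_compatible : forall c c', atlas c -> atlas c' -> compatible c c';
  atlas_maximal :
    forall c, (forall c', atlas c' -> compatible c c') -> atlas c }.

Variable S : smooth_structure.

Definition smooth_function (f : X -> R) : Prop :=
  forall c, atlas S c -> smooth_on (cod c) (fun y => f (param c y)).

Record riemannian_metric := RiemannianMetric {
  metric : chart -> 'rV[R]_n -> 'M[R]_n;
  metric_smooth : forall c, atlas S c ->
    forall i j, smooth_on (cod c) (fun y => metric c y i j);
  metric_sym : forall c, atlas S c ->
    forall y, cod c y -> (metric c y)^T = metric c y;
  metric_pos : forall c, atlas S c -> forall y, cod c y ->
    forall v : 'rV[R]_n, v != 0 -> 0 < (v *m metric c y *m v^T) 0 0;
  metric_change : forall c c', atlas S c -> atlas S c' ->
    forall y, overlap c c' y ->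
    metric c y =
      'J (transition c c') y *m metric c' (transition c c' y)
        *m ('J (transition c c') y)^T }.

(* p-linear alternating functions of the p rows of a matrix; the formulation  *)
(* is that of determinant_multilinear and determinant_alternate.              *)
Definition alternating_multilinear (p : nat) (w : 'M[R]_(p, n) -> R) : Prop :=
  (forall (V V1 V2 : 'M[R]_(p, n)) (i : 'I_p) (a b : R),
     row i V = a *: row i V1 + b *: row i V2 ->
     row' i V1 = row' i V -> row' i V2 = row' i V ->
     w V = a * w V1 + b * w V2) /\
  (forall (V : 'M[R]_(p, n)) (i j : 'I_p),
     i != j -> row i V = row j V -> w V = 0).

Record diff_form (p : nat) := DiffForm {
  form : chart -> 'rV[R]_n -> 'M[R]_(p, n) -> R;
  form_smooth : forall c, atlas S c ->
    forall V, smooth_on (cod c) (fun y => form c y V);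
  form_alternating : forall c, atlas S c ->
    forall y, cod c y -> alternating_multilinear (form c y);
  form_change : forall c c', atlas S c -> atlas S c' ->
    forall y, overlap c c' y -> forall V,
    form c y V = form c' (transition c c' y) (V *m 'J (transition c c') y) }.

(* (d phi)_y (v_0, ..., v_p)                                                  *)
(*   = \sum_i (-1)^i D_{v_i} (phi (v_0, ..., v_{i-1}, v_{i+1}, ..., v_p)) (y) *)
(* where the v_i are the rows of V, extended as constant fields in the chart. *)
Definition exterior_derivative (p : nat) (phi : diff_form p) (c : chart)
    (y : 'rV[R]_n) (V : 'M[R]_(p.+1, n)) : R :=
  \sum_(i < p.+1)
    (-1) ^+ i * 'D_(row i V) (fun z => form phi c z (row' i V)) y.

Definition closed_form (p : nat) (phi : diff_form p) : Prop :=
  forall c, atlas S c -> forall y, cod c y ->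
  forall V, exterior_derivative phi c y V = 0.

Section LeviCivita.
Variable g : riemannian_metric.

(* The Christoffel symbol \Gamma^k_{ij} of the Levi-Civita connection; see    *)
(* christoffel_sym and christoffel_metric below.                              *)
Definition christoffel (c : chart) (y : 'rV[R]_n) (k i j : 'I_n) : R :=
  2^-1 * \sum_(l < n) invmx (metric g c y) k l *
    (pderiv i (fun z => metric g c z j l) y
     + pderiv j (fun z => metric g c z i l) y
     - pderiv l (fun z => metric g c z i j) y).

Lemma metric_unitmx c y : atlas S c -> cod c y -> metric g c y \in unitmx.
Proof.
move=> Sc cy; rewrite -row_free_unit -kermx_eq0; apply/negPn/negP => /rowV0Pn.
move=> [v /sub_kermxP vG v0]; have := metric_pos g Sc cy v0.
by rewrite vG mul0mx mxE ltxx.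
Qed.

Lemma pderiv_metric_sym c y : atlas S c -> cod c y -> forall k i j,
  pderiv k (fun z => metric g c z i j) y = pderiv k (fun z => metric g c z j i) y.
Proof.
move=> Sc cy k i j; apply: near_eq_derive.
have : nbhs y (cod c) by apply: open_nbhs_nbhs; split => //; exact: cod_open.
apply: filterS => z cz /=.
by rewrite -[in LHS](metric_sym g Sc cz) mxE.
Qed.

(* Vanishing torsion. *)
Lemma christoffel_sym c y : atlas S c -> cod c y -> forall k i j,
  christoffel c y k i j = christoffel c y k j i.
Proof.
move=> Sc cy k i j; rewrite /christoffel; congr (_ * _); apply: eq_bigr => l _.
by rewrite (pderiv_metric_sym Sc cy l i j) [X in X - _]addrC.
Qed.

Lemma christoffel_lower c y : atlas S c -> cod c y -> forall k i j,
  \sum_(l < n) christoffel c y l k i * metric g c y l j =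
  2^-1 * (pderiv k (fun z => metric g c z i j) y
          + pderiv i (fun z => metric g c z k j) y
          - pderiv j (fun z => metric g c z k i) y).
Proof.
move=> Sc cy k i j; rewrite /christoffel.
pose B r := pderiv k (fun z => metric g c z i r) y
  + pderiv i (fun z => metric g c z k r) y
  - pderiv r (fun z => metric g c z k i) y.
rewrite -/(B j); under eq_bigr do rewrite -mulrA mulr_suml.
rewrite -mulr_sumr; congr (_ * _); rewrite exchange_big /=.
have E r : \sum_(l < n) invmx (metric g c y) l r * B r * metric g c y l j
    = (j == r)%:R * B r.
  have -> : (j == r)%:R = (metric g c y *m invmx (metric g c y)) j r :> R.
    by rewrite mulmxV ?metric_unitmx// mxE.
  rewrite mxE mulr_suml; apply: eq_bigr => l _.
  have -> : metric g c y l j = metric g c y j l.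
    by rewrite -[in LHS](metric_sym g Sc cy) mxE.
  by rewrite mulrC mulrA.
rewrite (eq_bigr (fun r => (j == r)%:R * B r)); last by move=> r _; exact: E.
rewrite (bigD1 j) //= eqxx mul1r big1 ?addr0// => r rj.
by rewrite eq_sym (negbTE rj) mul0r.
Qed.

(* Compatibility with the metric. *)
Lemma christoffel_metric c y : atlas S c -> cod c y -> forall k i j,
  pderiv k (fun z => metric g c z i j) y =
  \sum_(l < n) (christoffel c y l k i * metric g c y l j
                + christoffel c y l k j * metric g c y i l).
Proof.
move=> Sc cy k i j; rewrite big_split /= christoffel_lower//.
have -> : \sum_(l < n) christoffel c y l k j * metric g c y i l =
    \sum_(l < n) christoffel c y l k j * metric g c y l i.
  by apply: eq_bigr => l _; rewrite -[in LHS](metric_sym g Sc cy) mxE.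
rewrite christoffel_lower// (pderiv_metric_sym Sc cy k j i).
lra.
Qed.

(* nabla_v W at the point y of the chart c, for a vector field W. *)
Definition covariant_derivative (c : chart) (W : 'rV[R]_n -> 'rV[R]_n)
    (y v : 'rV[R]_n) : 'rV[R]_n :=
  'D_v W y
  + \row_k \sum_(i < n) \sum_(j < n) christoffel c y k i j * v 0 i * W y 0 j.

Definition gradient (f : X -> R) (c : chart) (y : 'rV[R]_n) : 'rV[R]_n :=
  (\row_i pderiv i (fun z => f (param c z)) y) *m invmx (metric g c y).

End LeviCivita.

Section Calibration.
Variables (g : riemannian_metric) (p : nat) (phi : diff_form p).

(* A simple p-vector v_1 /\ ... /\ v_p is represented by the matrix V of rows *)
(* v_1, ..., v_p; its norm is the square root of the Gram determinant, and    *)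
(* its span is the row space of V.                                            *)
Definition simple_norm (c : chart) (y : 'rV[R]_n) (V : 'M[R]_(p, n)) : R :=
  Num.sqrt (\det (V *m metric g c y *m V^T)).

Definition calibration : Prop :=
  closed_form phi /\
  forall c, atlas S c -> forall y, cod c y ->
  forall V, simple_norm c y V = 1 -> form phi c y V <= 1.

(* V represents an element of G_x(phi), with x = param c y. *)
Definition phi_plane (c : chart) (y : 'rV[R]_n) (V : 'M[R]_(p, n)) : Prop :=
  simple_norm c y V = 1 /\ form phi c y V = 1.

Definition replace_row (i : 'I_p) (w : 'rV[R]_n) (V : 'M[R]_(p, n)) :=
  \matrix_(k < p) (if k == i then w else row k V).

Definition phi_hessian (f : X -> R) (c : chart) (y : 'rV[R]_n)
    (V : 'M[R]_(p, n)) : R :=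
  \sum_(i < p) form phi c y
    (replace_row i (covariant_derivative g c (gradient g f c) y (row i V)) V).

Definition strictly_psh_at (f : X -> R) (x : X) : Prop :=
  forall c, atlas S c -> dom c x ->
  forall V, phi_plane c (coord c x) V -> 0 < phi_hessian f c (coord c x) V.

End Calibration.

Section Submanifold.
Variables (m : nat) (M : set X).

Definition slice_chart (c : chart) : Prop :=
  atlas S c /\
  forall x, dom c x ->
    (M x <-> forall i : 'I_n, (m <= i)%N -> coord c x 0 i = 0).

Definition closed_submanifold : Prop :=
  [/\ (m <= n)%N, closed M &
      forall x, M x -> exists2 c, slice_chart c & dom c x].

(* T_x M, for x in M, as a subspace of T_x X read in the chart c. *)
Definition tangent_space (c : chart) (x : X) : set 'rV[R]_n :=
  [set w | exists2 s, slice_chart s /\ dom s x &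
     forall i : 'I_n, (m <= i)%N ->
       (w *m 'J (transition c s) (coord c x)) 0 i = 0].

Definition phi_free (g : riemannian_metric) (p : nat) (phi : diff_form p)
    : Prop :=
  ~ exists x c (V : 'M[R]_(p, n)),
      [/\ M x, atlas S c /\ dom c x, phi_plane g phi c (coord c x) V &
          forall w : 'rV[R]_n, (w <= V)%MS -> tangent_space c x w].

End Submanifold.
End Manifold.

(* Main.v *)
Require Import Defs.
From HB Require Import structures.
From mathcomp Require Import all_boot all_order all_algebra.
From mathcomp Require Import all_classical all_reals all_analysis.
From mathcomp Require Import ring lra.
Set Implicit Arguments.
Unset Strict Implicit.
Unset Printing Implicit Defensive.
Import Order.TTheory GRing.Theory Num.Theory.
Import numFieldNormedType.Exports.
Local Open Scope classical_set_scope.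
Local Open Scope ring_scope.

(* Imported again, so that coord, form and metric refer to charts, differential
forms and Riemannian metrics. *)
Require Import Defs.

(** The phi-Hessian of f on a phi-plane is the trace over the plane of the
covariant Hessian of f. Indeed phi attains its maximum over the unit simple
vectors at a phi-plane V; moving one row of V in a direction orthogonal to the plane
changes the volume to second order only, so phi vanishes when a row of V is replaced
by a vector orthogonal to the plane (comass_max), and of the vectors nabla_v (grad f)
only the components along the plane count (comass_trace, phi_hessian_trace). In a
slice chart of M let u be the sum of the squares of the coordinates that vanish on
M. Along M its first derivatives vanish and its Hessian is twice the square of the
normal component, so the trace of its Hessian over a phi-plane at a point of M is
nonnegative, and zero only if the plane is tangent to M; phi-freeness excludes this
(free_normal_gt0, trace_slice_fun).

The function f is built as a countable sum of smooth functions that are nonnegative,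
vanish on A and have nonnegative traces on M. These admissible functions form a
cone, and with sufficiently small weights any sequence of them can be summed in the
C^oo topology (weighted_sum, admissible_sum). It is then enough to find, near every
single point, an admissible function with the strict property that is wanted there,
and to pass to a countable family (lindelof). Near a point of M, the product of u
with a bump has a strictly positive trace (admissible_strict). Near a point outside
M, a bump supported off M is positive (admissible_pos_off). Near a point of M
outside A, a bump supported off A is positive, but its traces may be negative; they
are compensated by a large multiple of the product of u with a wider bump, whose
traces are bounded below on the compact set of phi-planes over the part of M in the
support (admissible_pos_on). In this way the zero set is prescribed and the traces
are kept under control at the same time.

Two general facts are needed about the notion itself. Strict plurisubharmonicity
quantifies over all charts; it can be tested in a single one since the Hessian is a
tensor, by the transformation law of the Christoffel symbols (christoffel_change,
hessian_change), which rests on the symmetry of second derivatives (pderivC). And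
it is an open condition, because the orthonormal frames of the phi-planes over a
compact set form a compact set (planes_over_compact, traces_gt0_open); every
phi-plane has such a frame by Cholesky factorization of its Gram matrix. *)

(** * Differentiability and partial derivatives *)

Section Differentiability.
Context {R : realType}.

Lemma differentiable_estimate (V W : normedModType R) (f : V -> W)
    (df : {linear V -> W}) (x : V) : continuous df ->
  (forall e, 0 < e -> \forall h \near 0, `|f (h + x) - f x - df h| <= e * `|h|) ->
  differentiable f x /\ 'd f x = df :> (V -> W).
Proof.
move=> dfc est.
have E : f \o shift x = cst (f x) + df +o_ 0 id.
  apply/eqaddoP => e e0; have := est e e0.
  by apply: filterS => h /=; rewrite !fctE /= opprD addrA.
have dE := diff_unique dfc E; split => //.
by apply/diff_locallyP; rewrite dE.
Qed.

Lemma near_eq_differentiable (V W : normedModType R) (f g : V -> W) (x : V) :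
  (\forall y \near x, f y = g y) -> differentiable f x -> differentiable g x.
Proof.
move=> fg df.
apply: (proj1 (@differentiable_estimate _ _ g ('d f x) x _ _)).
  exact: diff_continuous.
move=> e e0.
have [_ /eqaddoP/(_ e e0)] := proj1 (diff_locallyP _ _) df.
have fg' : \forall h \near (0 : V), f (h + x) = g (h + x).
  by move: fg; rewrite (near_shift 0)/=; apply: filterS => h /=; rewrite subr0.
apply: filter_app; apply: filterS fg' => h fgh.
by rewrite !fctE /= opprD addrA fgh (nbhs_singleton fg).
Qed.

End Differentiability.

Section Partial.
Context {R : realType} {n : nat}.
Implicit Types (f g : 'rV[R]_n -> R) (U : set 'rV[R]_n) (y v : 'rV[R]_n).

Lemma pderivE i f y : differentiable f y -> pderiv i f y = 'd f y (delta_mx 0 i).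
Proof. by move=> df; rewrite /pderiv deriveE. Qed.

Lemma diff_pderiv f y v : differentiable f y ->
  'd f y v = \sum_i v 0 i * pderiv i f y.
Proof.
move=> df; rewrite {1}(row_sum_delta v) linear_sum; apply: eq_bigr => i _.
by rewrite linearZ /= pderivE.
Qed.

Lemma pderiv_cst i (c : R) y : pderiv i (cst c) y = 0.
Proof. by rewrite /pderiv derive_cst. Qed.

Lemma pderivD i f g y : differentiable f y -> differentiable g y ->
  pderiv i (f \+ g) y = pderiv i f y + pderiv i g y.
Proof. by move=> df dg; rewrite /pderiv deriveD//; apply: diff_derivable. Qed.

Lemma pderivM i f g y : differentiable f y -> differentiable g y ->
  pderiv i (f \* g) y = f y * pderiv i g y + pderiv i f y * g y.
Proof.
move=> df dg; rewrite /pderiv deriveM; [|exact: diff_derivable..].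
by rewrite /GRing.scale /= [X in _ + X]mulrC.
Qed.

Lemma pderiv_sum i k (F : 'I_k -> 'rV[R]_n -> R) y :
  (forall j, differentiable (F j) y) ->
  pderiv i (\sum_j F j) y = \sum_j pderiv i (F j) y.
Proof. by move=> dF; rewrite /pderiv derive_sum// => j; exact: diff_derivable. Qed.

Lemma near_eq_pderiv i f g y : (\forall z \near y, f z = g z) ->
  pderiv i f y = pderiv i g y.
Proof. by move=> fg; apply: near_eq_derive. Qed.

Lemma open_near U y (P : 'rV[R]_n -> Prop) : open U -> U y ->
  (forall z, U z -> P z) -> \forall z \near y, P z.
Proof. by move=> oU Uy UP; apply: filterS UP _; exact: open_nbhs_nbhs. Qed.

Lemma differentiable_rV (T : normedModType R) k (F : T -> 'rV[R]_k) (t : T) :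
  (forall j, differentiable (fun s => F s 0 j) t) -> differentiable F t.
Proof.
move=> dF; rewrite (_ : F = \sum_(j < k) (fun s => F s 0 j *: delta_mx 0 j)).
  by apply: differentiable_sum => j; apply: differentiableZl.
by apply/funext => s; rewrite fct_sumE; exact: row_sum_delta.
Qed.

Lemma differentiable_entry (T : normedModType R) k (F : T -> 'rV[R]_k) t j :
  differentiable F t -> differentiable (fun s => F s 0 j) t.
Proof.
move=> dF; apply: (@differentiable_comp _ _ _ _ F (fun M : 'rV_k => M 0 j)) => //.
exact: differentiable_coord.
Qed.

Lemma diff_rV (T : normedModType R) k (F : T -> 'rV[R]_k) (t v : T) j :
  differentiable F t ->
  'd F t v 0 j = 'd (fun s => F s 0 j) t v.
Proof.
move=> dF.
have dF' := differentiable_entry j dF.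
rewrite -!deriveE// derive_mx; last exact: diff_derivable.
by rewrite mxE.
Qed.

Lemma jacobianE (F : 'rV[R]_n -> 'rV[R]_n) y i j : differentiable F y ->
  'J F y i j = pderiv i (fun z => F z 0 j) y.
Proof.
move=> dF; rewrite /jacobian mxE diff_rV// pderivE//.
exact: (@differentiable_entry _ _ _ _ j dF).
Qed.

Lemma differentiable_compR f (F : 'rV[R]_n -> 'rV[R]_n) y :
  differentiable F y -> differentiable f (F y) ->
  differentiable (fun z => f (F z)) y.
Proof. by move=> dF df; apply: differentiable_comp. Qed.

Lemma pderiv_comp f (F : 'rV[R]_n -> 'rV[R]_n) y i :
  differentiable F y -> differentiable f (F y) ->
  pderiv i (fun z => f (F z)) y =
  \sum_j pderiv i (fun z => F z 0 j) y * pderiv j f (F y).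
Proof.
move=> dF df; rewrite pderivE; last exact: differentiable_compR.
rewrite (_ : 'd _ y _ = ('d f (F y) \o 'd F y) (delta_mx 0 i)); last first.
  by rewrite -diff_comp.
rewrite /= diff_pderiv//; apply: eq_bigr => j _; rewrite diff_rV//; congr (_ * _).
rewrite pderivE//; exact: (@differentiable_entry _ _ _ _ j dF).
Qed.

(** ** Smooth functions *)

(** The functions generated on U by a family P under sums, products and equality
on U.  A family whose partial derivatives all lie in the algebra it generates
consists of smooth functions; every closure property of smoothness used below,
including composition and division, is an instance of this principle. *)
Inductive generated U (P : ('rV[R]_n -> R) -> Prop) : ('rV[R]_n -> R) -> Prop :=
| gen_base f : P f -> generated U P f
| gen_cst c : generated U P (cst c)
| gen_add f g : generated U P f -> generated U P g -> generated U P (f \+ g)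
| gen_mul f g : generated U P f -> generated U P g -> generated U P (f \* g)
| gen_ext f g : (forall y, U y -> f y = g y) -> generated U P f ->
    generated U P g.

Lemma generated_sum U P k (F : 'I_k -> 'rV[R]_n -> R) :
  (forall j, generated U P (F j)) -> generated U P (fun y => \sum_j F j y).
Proof.
move=> PF; rewrite (_ : (fun y => _) = \sum_j F j); last first.
  by apply/funext => y; rewrite fct_sumE.
elim/big_ind : _ => //; first exact: gen_cst.
by move=> f g; exact: gen_add.
Qed.

Lemma generated_smooth U P : open U ->
  (forall f, P f -> forall y, U y -> differentiable f y) ->
  (forall f i, P f -> generated U P (pderiv i f)) ->
  forall f, generated U P f -> smooth_on U f.
Proof.
move=> oU Pd Pp.
have gd f : generated U P f -> forall y, U y -> differentiable f y.
  elim => [{}f /Pd//|c y Uy|{}f g _ IHf _ IHg y Uy|{}f g _ IHf _ IHg y Uy|].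
  - exact: differentiable_cst.
  - by apply: differentiableD; [exact: IHf|exact: IHg].
  - by apply: differentiableM; [exact: IHf|exact: IHg].
  - move=> {}f g fg _ IH y Uy; apply: near_eq_differentiable (IH y Uy).
    exact: open_near fg.
have gp f i : generated U P f -> generated U P (pderiv i f).
  elim => [{}f /Pp//|c|{}f g gf IHf gg IHg|{}f g gf IHf gg IHg|].
  - by apply: gen_ext (gen_cst _ _ 0) => y Uy; rewrite pderiv_cst.
  - apply: gen_ext (gen_add IHf IHg) => y Uy /=.
    by rewrite pderivD//; [exact: gd Uy|exact: gd Uy].
  - apply: gen_ext (gen_add (gen_mul gf IHg) (gen_mul IHf gg)) => y Uy /=.
    by rewrite pderivM//; [exact: gd Uy|exact: gd Uy].
  - move=> {}f g fg _; apply: gen_ext => y Uy; apply: near_eq_pderiv.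
    exact: open_near fg.
move=> f gf s; apply: gd; elim: s => //= i s; exact: gp.
Qed.

Lemma smooth_differentiable U f y : smooth_on U f -> U y -> differentiable f y.
Proof. by move=> sf; exact: (sf [::]). Qed.

Lemma smooth_iter_pderiv U f s : smooth_on U f -> smooth_on U (iter_pderiv s f).
Proof. by move=> sf t y; rewrite /iter_pderiv -foldr_cat; exact: sf. Qed.

Lemma smooth_pderiv U f i : smooth_on U f -> smooth_on U (pderiv i f).
Proof. exact: (@smooth_iter_pderiv _ _ [:: i]). Qed.

Lemma sub_smooth U U' f : U `<=` U' -> smooth_on U' f -> smooth_on U f.
Proof. by move=> UU' sf s y /UU'; exact: sf. Qed.

Lemma smooth_near U f : (forall y, U y -> exists2 U', U' y & smooth_on U' f) ->
  smooth_on U f.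
Proof. by move=> H s y Uy; have [U' U'y] := H y Uy; apply. Qed.

Lemma smooth_generated U f : open U -> generated U (smooth_on U) f ->
  smooth_on U f.
Proof.
move=> oU; apply: generated_smooth => // [{}f sf y|{}f i sf].
  exact: smooth_differentiable.
exact/gen_base/smooth_pderiv.
Qed.

Lemma smooth_ext U f g : open U -> (forall y, U y -> f y = g y) ->
  smooth_on U f -> smooth_on U g.
Proof. by move=> oU fg sf; apply: smooth_generated => //; apply: gen_ext fg (gen_base _ _). Qed.

Lemma smooth_cst U c : open U -> smooth_on U (cst c).
Proof. by move=> oU; apply: smooth_generated => //; apply: gen_cst. Qed.

Lemma smoothD U f g : open U -> smooth_on U f -> smooth_on U g ->
  smooth_on U (f \+ g).
Proof.
by move=> oU sf sg; apply: smooth_generated => //; apply: gen_add; exact: gen_base.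
Qed.

Lemma smoothM U f g : open U -> smooth_on U f -> smooth_on U g ->
  smooth_on U (f \* g).
Proof.
by move=> oU sf sg; apply: smooth_generated => //; apply: gen_mul; exact: gen_base.
Qed.

Lemma smooth_sum U k (F : 'I_k -> 'rV[R]_n -> R) : open U ->
  (forall j, smooth_on U (F j)) -> smooth_on U (fun y => \sum_j F j y).
Proof.
move=> oU sF; apply: smooth_generated => //; apply: generated_sum => j.
exact: gen_base.
Qed.

Lemma pderiv_coord i j y : pderiv i (fun z : 'rV[R]_n => z 0 j) y = (i == j)%:R.
Proof.
rewrite /pderiv.
have /(congr1 (fun M : 'rV[R]_n => M 0 j)) :=
  derive_mx (@derivable_id R 'rV[R]_n y (delta_mx 0 i)).
by rewrite derive_id !mxE eqxx /= eq_sym => ->.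
Qed.

Lemma smooth_coord U j : open U -> smooth_on U (fun z => z 0 j).
Proof.
move=> oU; pose P f := f = (fun z : 'rV[R]_n => z 0 j).
apply: (@generated_smooth U P oU); last exact: gen_base.
- by move=> _ -> y _; exact: differentiable_coord.
- move=> _ i ->; apply: gen_ext (gen_cst _ _ (i == j)%:R) => y _.
  by rewrite pderiv_coord.
Qed.

Lemma smooth_map_differentiable U (F : 'rV[R]_n -> 'rV[R]_n) y :
  smooth_map_on U F -> U y -> differentiable F y.
Proof.
by move=> sF Uy; apply: differentiable_rV => j; exact: smooth_differentiable (sF j) Uy.
Qed.

Lemma smooth_comp U U' f (F : 'rV[R]_n -> 'rV[R]_n) : open U ->
  smooth_map_on U F -> (forall y, U y -> U' (F y)) -> smooth_on U' f ->
  smooth_on U (fun y => f (F y)).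
Proof.
move=> oU sF UU' sf.
pose P h := smooth_on U h \/ exists2 k, smooth_on U' k & h = (fun y => k (F y)).
apply: (@generated_smooth U P oU); last by apply: gen_base; right; exists f.
- move=> h [sh y Uy|[k sk ->] y Uy]; first exact: smooth_differentiable sh Uy.
  apply: differentiable_compR; first exact: smooth_map_differentiable sF Uy.
  exact: smooth_differentiable sk (UU' _ Uy).
- move=> h i [sh|[k sk ->]]; first by apply: gen_base; left; exact: smooth_pderiv.
  have G j : generated U P (pderiv i (fun z => F z 0 j) \* (pderiv j k \o F)).
    apply: gen_mul; apply: gen_base; first by left; apply/smooth_pderiv/sF.
    by right; exists (pderiv j k) => //; exact: smooth_pderiv.
  apply: gen_ext (generated_sum G) => y Uy.
  rewrite pderiv_comp//; first exact: smooth_map_differentiable sF Uy.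
  exact: smooth_differentiable sk (UU' _ Uy).
Qed.

Lemma differentiable_comp1 (h : R -> R) f y : differentiable f y ->
  derivable h (f y) 1 -> differentiable (h \o f) y.
Proof. by move=> df /derivable1_diffP dh; exact: differentiable_comp. Qed.

Lemma pderiv_comp1 (h : R -> R) f y i : differentiable f y ->
  derivable h (f y) 1 -> pderiv i (h \o f) y = 'D_1 h (f y) * pderiv i f y.
Proof.
move=> df dh; rewrite pderivE; last exact: differentiable_comp1.
have dh' : differentiable h (f y) by exact/derivable1_diffP.
rewrite diff_comp//= -pderivE// deriveE//.
by rewrite -[pderiv i f y in LHS]mulr1 -[_ * 1]/(_ *: 1) linearZ /= mulrC.
Qed.

Lemma smooth_inv U f : open U -> (forall y, U y -> f y != 0) ->
  smooth_on U f -> smooth_on U (fun y => (f y)^-1).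
Proof.
move=> oU f0 sf; pose P h := smooth_on U h \/ h = (fun y => (f y)^-1).
have dinv y : U y -> derivable (@GRing.inv R) (f y) 1.
  by move=> Uy; apply: (@derivableV _ _ id) => //; exact: f0.
apply: (@generated_smooth U P oU); last by apply: gen_base; right.
- move=> h [sh y Uy|-> y Uy]; first exact: smooth_differentiable sh Uy.
  apply: differentiable_comp1; last exact: dinv.
  exact: smooth_differentiable sf Uy.
- move=> h i [sh|->]; first by apply: gen_base; left; exact: smooth_pderiv.
  have Pi : generated U P (fun y => (f y)^-1) by apply: gen_base; right.
  have Pf : generated U P (pderiv i f).
    by apply: gen_base; left; exact: smooth_pderiv.
  apply: gen_ext (gen_mul (gen_mul (gen_cst _ _ (-1)) Pf) (gen_mul Pi Pi)).
  move=> y Uy /=.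
  rewrite (@pderiv_comp1 (@GRing.inv R) f)//; last 2 first.
  - exact: smooth_differentiable sf Uy.
  - exact: dinv.
  rewrite (@deriveV _ _ id)//; last exact: f0.
  rewrite derive_id /GRing.scale /= mulr1 -expr2 exprVn; lra.
Qed.

End Partial.

(** ** Flat functions *)

Section Flat.
Context {R : realType}.

(** The case k = 0 is the classical flat function; the other exponents are those
produced by differentiating it. *)
Definition flat (k : nat) (t : R) : R :=
  if 0 < t then t ^- k * expR (- t^-1) else 0.

Lemma flat_ge0 k t : 0 <= flat k t.
Proof.
rewrite /flat; case: ifP => // t0.
by rewrite mulr_ge0 ?expR_ge0// invr_ge0 exprn_ge0// ltW.
Qed.

Lemma flat_gt0 k t : 0 < t -> 0 < flat k t.
Proof. by move=> t0; rewrite /flat t0 mulr_gt0 ?expR_gt0// invr_gt0 exprn_gt0. Qed.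

Lemma flat_eq0 k t : t <= 0 -> flat k t = 0.
Proof. by rewrite /flat; case: ltgtP. Qed.

(** The exponential beats every power of 1/t. The quadratic bound is what makes
flat k differentiable at 0, with derivative 0. *)
Lemma flat_le k t : flat k t <= k.+2`!%:R * t ^+ 2.
Proof.
have [t0|t0] := leP t 0; first by rewrite flat_eq0// mulr_ge0// sqr_ge0.
rewrite /flat t0 ler_pdivrMl ?exprn_gt0// expRN.
rewrite -[leLHS]mul1r ler_pdivrMr ?expR_gt0//.
have := @expR_ge1Dxn R t^-1 k.+1; rewrite invr_ge0 ltW// => /(_ isT) ex.
have tk : 0 < t ^+ k.+2 by rewrite exprn_gt0.
have fk : 0 < k.+2`!%:R :> R by rewrite ltr0n fact_gt0.
rewrite [t ^+ k * _]mulrCA -exprD addn2.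
apply: le_trans (_ : k.+2`!%:R * t ^+ k.+2 * (1 + t^-1 ^+ k.+2 / k.+2`!%:R) <= _).
  rewrite mulrDr mulr1 mulrACA exprVn [X in _ + X](_ : _ = 1).
    by rewrite lerDr mulr_ge0// ltW.
  by field; rewrite !gt_eqF.
by rewrite ler_pM2l// mulr_gt0.
Qed.

(** The flat functions are stable under differentiation up to linear
combinations, which makes them smooth. *)
Lemma is_derive_flat k (t : R) :
  is_derive t (1 : R) (flat k) (- k%:R * flat k.+1 t + flat k.+2 t).
Proof.
have [t0|t0|t0] := ltgtP t 0.
- rewrite !(flat_eq0 _ (ltW t0)) mulr0 addr0.
  apply: (@near_eq_is_derive _ _ _ (cst 0)).
  by near=> s; rewrite flat_eq0//; apply: ltW; near: s; exact: lt_nbhsl.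
- have tn0 : t != 0 by rewrite gt_eqF.
  have near_flat : \forall s \near t, s ^- k * expR (- s^-1) = flat k s.
    by near=> s; rewrite /flat ifT//; near: s; exact: lt_nbhsr.
  have tk0 : t ^+ k != 0 by rewrite expf_neq0.
  have dX : derivable (fun s : R => s ^+ k) t 1 by exact: exprn_derivable.
  have dXV : is_derive t 1 (fun s : R => (s ^+ k)^-1)
      (- (t ^+ k) ^- 2 * (k%:R * t ^+ k.-1)).
    pose f (s : R) := s ^+ k.
    have dfV := @derivableV R R f t 1 tk0 dX.
    have := @deriveV R R f t 1 tk0 dX; rewrite exp_derive [LHS]/= => dE.
    by split => //; rewrite dE /GRing.scale /= mulr1.
  have dId := @derivableV R R id t 1 tn0 (@derivable_id R R t 1).
  have dV : is_derive t 1 (fun s : R => - s^-1) (t ^- 2).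
    split; first exact: derivableN dId.
    have := deriveN dId; rewrite (@deriveV R R id t 1 tn0 (@derivable_id R R t 1)).
    by rewrite derive_id scaleNr opprK /GRing.scale /= mulr1.
  have dE := @is_derive1_comp R expR (fun s => - s^-1) t _ _ (is_derive_expR _) dV.
  apply: near_eq_is_derive near_flat _.
  apply: is_derive_eq (is_deriveM dXV dE) _.
  rewrite /flat t0 /GRing.scale /=.
  case: k {dX dXV} tk0 => [|k] tk0; first by rewrite !expr0; field.
  move: tk0; rewrite /= -!natr1 !exprS; move: (t ^+ k) => u.
  by rewrite mulf_eq0 negb_or tn0 /= => u0; field; rewrite u0 tn0.
- rewrite t0 !(flat_eq0 _ (lexx _)) mulr0 addr0.
  have [| |df dE] := @differentiable_estimate _ _ _ (flat k) (\0 : {linear R^o -> R^o}) 0.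
  - by move=> x; exact: cvg_cst.
  - move=> e e0; near=> h.
    rewrite addr0 (flat_eq0 _ (lexx _)) /= !subr0 ger0_norm ?flat_ge0//.
    apply: le_trans (flat_le _ _) _.
    rewrite -[h ^+ 2]ger0_norm ?sqr_ge0// normrX expr2 mulrA ler_wpM2r//.
    rewrite -ler_pdivlMl ?ltr0n ?fact_gt0//.
    by near: h; apply: (@nbhs0_le _ R); rewrite mulr_gt0// invr_gt0 ltr0n fact_gt0.
  - apply: DeriveDef; first exact/derivable1_diffP.
    by rewrite deriveE// dE.
Unshelve. all: by end_near. Qed.

End Flat.

Lemma cvg_sumr {R : realType} {T I : Type} (G : set_system T) (FG : Filter G)
    (r : seq I) (F : I -> T -> R) (l : I -> R) :
  (forall i, F i x @[x --> G] --> l i) ->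
  \sum_(i <- r) F i x @[x --> G] --> \sum_(i <- r) l i.
Proof. by move=> Fl; apply: cvg_big => //; exact: add_continuous. Qed.

Section Calculus.
Context {R : realType} {n : nat}.
Implicit Types (f g : 'rV[R]_n -> R) (U B : set 'rV[R]_n) (y v : 'rV[R]_n).

Lemma smooth_flat U f : open U -> smooth_on U f -> smooth_on U (flat 0 \o f).
Proof.
move=> oU sf; pose P h := smooth_on U h \/ exists k, h = flat k \o f.
apply: (@generated_smooth _ _ U P oU); last by apply: gen_base; right; exists 0%N.
- move=> h [sh y Uy|[k ->] y Uy]; first exact: smooth_differentiable sh Uy.
  apply: differentiable_comp1; first exact: smooth_differentiable sf Uy.
  by have [] := is_derive_flat k (f y).
- move=> h i [sh|[k ->]]; first by apply: gen_base; left; exact: smooth_pderiv.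
  have Pk j : generated U P (flat j \o f) by apply: gen_base; right; exists j.
  have Pf : generated U P (pderiv i f).
    by apply: gen_base; left; exact: smooth_pderiv.
  apply: gen_ext (gen_mul (gen_add (gen_mul (gen_cst _ _ (- k%:R)) (Pk k.+1))
    (Pk k.+2)) Pf) => y Uy.
  have [dk dkE] := is_derive_flat k (f y).
  rewrite (pderiv_comp1 _ _ dk); last exact: smooth_differentiable sf Uy.
  by rewrite dkE.
Qed.

(** ** Mean values and the symmetry of second derivatives *)

Lemma MVT_line f y v : (forall s, 0 <= s <= 1 -> differentiable f (y + s *: v)) ->
  exists2 s : R, 0 <= s <= 1 &
    f (y + v) - f y = \sum_i v 0 i * pderiv i f (y + s *: v).
Proof.
move=> df.
pose h (s : R) := f (y + s *: v).
pose l (t : R) := y + t *: v.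
have [dl dlE] : (forall s, differentiable l s) /\ (forall s, 'd l s 1 = v).
  have dl s : is_diff (s : R) l (fun t : R => t *: v).
    by apply: is_diff_eq; rewrite add0r.
  by split=> s; have [// ds] := dl s; rewrite /l => ->; rewrite scale1r.
have dh (s : R) : 0 <= s <= 1 ->
    is_derive s 1 h (\sum_i v 0 i * pderiv i f (y + s *: v)).
  move=> /df dfs.
  have dhs : differentiable h s.
    by apply: (@differentiable_comp _ _ _ _ l).
  split; first exact/derivable1_diffP.
  rewrite deriveE// (_ : 'd h s 1 = ('d f (l s) \o 'd l s) 1).
    by rewrite /= dlE diff_pderiv.
  by rewrite -(@diff_comp _ _ _ _ l).
have [||s s01] := @MVT_segment R h (fun s => \sum_i v 0 i * pderiv i f (y + s *: v)) 0 1 ler01.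
- move=> s; rewrite in_itv /= => /andP[s0 s1].
  by apply: dh; rewrite (ltW s0) ltW.
- apply: continuous_in_subspaceT => s; rewrite inE /= in_itv /= => s01.
  apply: differentiable_continuous; apply/derivable1_diffP.
  by have [] := dh s s01.
- rewrite /h scale1r scale0r addr0 subr0 mulr1 => E.
  by exists s => //; move: s01; rewrite in_itv.
Qed.

Lemma norm_entry y i : `|y 0 i| <= `|y|.
Proof.
by rewrite [leRHS]/Num.Def.normr/= mx_normrE; apply: (le_bigmax _ _ (0, i)).
Qed.

Lemma norm_delta i : `|delta_mx 0 i : 'rV[R]_n| <= 1.
Proof.
rewrite /Num.Def.normr/= mx_normrE bigmax_le// => -[k j] _ /=.
by rewrite mxE; case: (_ && _); rewrite ?normr1 ?normr0.
Qed.

Lemma pderiv_shift f c y i :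
  pderiv i (fun z => f (z + c)) y = pderiv i f (y + c).
Proof.
rewrite /pderiv /derive; apply: (congr1 (fun q => lim (q @ _))).
by apply/funext => h /=; rewrite addrA.
Qed.

(** The mean value theorem in the direction i reduces the second difference to an
increment of d_i f, to which the first order expansion of d_i f at y applies. *)
Lemma second_difference f y i j : (\forall z \near y, differentiable f z) ->
  differentiable (pderiv i f) y -> forall e, 0 < e ->
  exists2 r, 0 < r & forall t, 0 < t < r ->
  `|f (y + t *: delta_mx 0 i + t *: delta_mx 0 j) - f (y + t *: delta_mx 0 i)
    - (f (y + t *: delta_mx 0 j) - f y) - t * (t * pderiv j (pderiv i f) y)|
  <= e * t ^+ 2.
Proof.
move=> df dg e e0; set a := delta_mx 0 i; set b := delta_mx 0 j.
set g := pderiv i f.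
have e4 : 0 < e / 4 by rewrite divr_gt0.
have [_ /eqaddoP/(_ _ e4)] := proj1 (diff_locallyP _ _) dg.
move=> /nbhs_ballP[r1 /= r10 est].
move: df => /nbhs_ballP[r2 /= r20 df].
have m0 : 0 < Num.min r1 r2 / 3 by rewrite divr_gt0// lt_min r10.
(* All points used below are within 2 * t of y, hence the factor 1 / 3. *)
exists (Num.min r1 r2 / 3) => // t /andP[t0 t3].
rewrite -{1}(gtr0_norm t0) in t3.
have ln (s u : R) : 0 <= s <= 1 -> `|s *: (t *: a) + u *: b| <= `|t| + `|u|.
  move=> /andP[s0 s1]; apply: le_trans (ler_normD _ _) _.
  rewrite !normrZ (ger0_norm s0); apply: lerD.
    rewrite -[leRHS]mul1r ler_pM ?mulr_ge0//.
    by rewrite -[leRHS]mulr1 ler_wpM2l// norm_delta.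
  by rewrite -[leRHS]mulr1 ler_wpM2l// norm_delta.
have l1 (s : R) : 0 <= s <= 1 -> `|s *: (t *: a) + t *: b| <= 2 * `|t|.
  by move=> s01; apply: le_trans (ln _ _ s01) _; rewrite mulr_natl mulr2n.
have l0 (s : R) : 0 <= s <= 1 -> `|s *: (t *: a)| <= 2 * `|t|.
  move=> s01; have := ln _ 0 s01; rewrite scale0r addr0 normr0 addr0 => H.
  by apply: le_trans H _; rewrite ler_peMl// ler1n.
have tr1 : 2 * `|t| < r1.
  have := lt_le_trans t3 (_ : _ <= r1 / 3); rewrite ler_pM2r// ge_min lexx.
  by move=> /(_ isT); have := normr_ge0 t; lra.
have tr2 : 2 * `|t| < r2.
  have := lt_le_trans t3 (_ : _ <= r2 / 3); rewrite ler_pM2r// ge_min lexx orbT.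
  by move=> /(_ isT); have := normr_ge0 t; lra.
have dfB h : `|h| <= 2 * `|t| -> differentiable f (y + h).
  move=> ht; apply: df; rewrite -ball_normE /= opprD addrA subrr sub0r normrN.
  exact: le_lt_trans tr2.
have gB h : `|h| <= 2 * `|t| -> `|g (y + h) - g y - 'd g y h| <= e / 2 * `|t|.
  move=> ht; have /= := est h; rewrite !fctE /= -ball_normE /= sub0r normrN.
  rewrite opprD addrA [h + y]addrC => H.
  apply: le_trans (H (le_lt_trans ht tr1)) _.
  have := ler_wpM2l (ltW e4) ht; lra.
pose G z := f (z + t *: b) - f z.
have shift_diff z : differentiable f (z + t *: b) ->
    differentiable (fun z => f (z + t *: b)) z.
  by move=> ?; apply: (@differentiable_comp _ _ _ _ (fun z => z + t *: b)).
have [|s s01] := @MVT_line G y (t *: a).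
  move=> s s01; apply: differentiableB.
    by apply: shift_diff; rewrite -addrA; apply: dfB; exact: l1.
  by apply: dfB; exact: l0.
rewrite /G => ->.
have D1 := dfB _ (l1 _ s01); have D0 := dfB _ (l0 _ s01).
rewrite addrA in D1.
rewrite (bigD1 i)//= big1 ?addr0; last first.
  by move=> k /negbTE ki; rewrite /a !mxE ki /= mulr0 mul0r.
rewrite {1}/a !mxE !eqxx mulr1.
have -> : pderiv i (fun z => f (z + t *: b) - f z) (y + s *: (t *: a)) =
    g (y + s *: (t *: a) + t *: b) - g (y + s *: (t *: a)).
  rewrite /pderiv deriveB; last 2 first.
  - by apply/diff_derivable/shift_diff.
  - exact: (diff_derivable D0).
  by rewrite -/(pderiv _ _ _) pderiv_shift.
rewrite -mulrBr normrM expr2.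
have := gB _ (l1 _ s01); have := gB _ (l0 _ s01).
have -> : 'd g y (s *: (t *: a) + t *: b) =
    'd g y (s *: (t *: a)) + t * pderiv j g y.
  by rewrite linearD; congr (_ + _); rewrite linearZ /= -pderivE.
rewrite -[X in _ -> _ -> _ <= e * X]real_normK ?num_real// expr2 mulrA.
move: ('d g y _) (pderiv j g y) => p q E0 E1.
rewrite [leRHS]mulrC ler_wpM2l//; rewrite addrA in E1.
apply: le_trans (_ : `|(g (y + s *: (t *: a) + t *: b) - g y - (p + t * q)) -
   (g (y + s *: (t *: a)) - g y - p)| <= _).
  by rewrite le_eqVlt; apply/orP; left; apply/eqP; congr (`|_|); ring.
by apply: le_trans (ler_normB _ _) _; lra.
Qed.

(** Both mixed derivatives are the limit of the same second difference quotient. *)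
Lemma pderivC f y i j : (\forall z \near y, differentiable f z) ->
  differentiable (pderiv i f) y -> differentiable (pderiv j f) y ->
  pderiv i (pderiv j f) y = pderiv j (pderiv i f) y.
Proof.
move=> df di dj; apply/eqP; rewrite -subr_eq0 -normr_le0.
apply/ler_addgt0Pl => e e0; rewrite addr0.
have e2 : 0 < e / 2 by rewrite divr_gt0.
have [r1 r10 Ei] := second_difference j df di e2.
have [r2 r20 Ej] := second_difference i df dj e2.
have m0 : 0 < Num.min r1 r2 by rewrite lt_min r10.
have [t0 t1 t2] : [/\ 0 < Num.min r1 r2 / 2, Num.min r1 r2 / 2 < r1 &
    Num.min r1 r2 / 2 < r2].
  have : Num.min r1 r2 <= r1 by rewrite ge_min lexx.
  have : Num.min r1 r2 <= r2 by rewrite ge_min lexx orbT.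
  by split; lra.
have := Ei (Num.min r1 r2 / 2); have := Ej (Num.min r1 r2 / 2).
rewrite t0 t1 t2 => /(_ isT) + /(_ isT).
move: (Num.min r1 r2 / 2) t0 => t t0 {t1 t2}.
have t2 : 0 < t ^+ 2 by rewrite exprn_gt0.
rewrite [y + t *: delta_mx 0 j + _]addrAC.
move: (pderiv i _ _) (pderiv j _ _) (f _) (f _) (f _) (f _) => p q a b c d E1 E2.
suff : `|p - q| * t ^+ 2 <= e * t ^+ 2 by rewrite ler_pM2r.
rewrite -{1}(gtr0_norm t2) -normrM.
apply: le_trans (_ : `|(d - b - (c - a) - t * (t * q)) -
   (d - c - (b - a) - t * (t * p))| <= _).
  by rewrite le_eqVlt; apply/orP; left; apply/eqP; congr (`|_|); ring.
by apply: le_trans (ler_normB _ _) _; rewrite [e]splitr mulrDl lerD.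
Qed.

(** ** Differentiation of series *)

Definition rapid (u : R^nat) := exists N, forall k, (N <= k)%N -> `|u k| <= 2^-1 ^+ k.

Lemma half_lt1 : `|2^-1 : R| < 1.
Proof. by rewrite ger0_norm ?invr_ge0//; lra. Qed.

Lemma geometric_half_cvg : cvgn (series (fun k => 2^-1 ^+ k : R)).
Proof.
have := @is_cvg_geometric_series R 1 2^-1 half_lt1.
by rewrite /geometric /=; under eq_fun do rewrite mul1r.
Qed.

Lemma abs_le_cvg (u w : R^nat) : (forall k, `|u k| <= w k) -> cvgn (series w) ->
  cvgn (series u).
Proof.
move=> uw cw; apply: normed_cvg.
by apply: series_le_cvg cw => k //=; apply: le_trans (uw k).
Qed.

Lemma abs_le_lim (u w : R^nat) : (forall k, `|u k| <= w k) -> cvgn (series w) ->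
  `|limn (series u)| <= limn (series w).
Proof.
move=> uw cw.
have cn : cvgn [normed series u].
  by apply: series_le_cvg cw => k //=; apply: le_trans (uw k).
apply: le_trans (lim_series_norm cn) _.
exact: lim_series_le.
Qed.

Lemma series_shift (u : R^nat) N m :
  series u (m + N)%N = series u N + series (fun k => u (k + N)%N) m.
Proof.
rewrite series_addn; congr (_ + _).
rewrite /series /= -{1}[N]add0n big_addn addnK.
by apply: eq_bigr => k _.
Qed.

Lemma cvg_series_shift (u : R^nat) N : cvgn (series (fun k => u (k + N)%N)) ->
  series u @ \oo --> series u N + limn (series (fun k => u (k + N)%N)).
Proof.
move=> cu; rewrite -(cvg_shiftn N).
under eq_fun do rewrite series_shift.
by apply: cvgD => //; exact: cvg_cst.
Qed.

Lemma rapid_shift (u : R^nat) N : (forall k, (N <= k)%N -> `|u k| <= 2^-1 ^+ k) ->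
  forall k, `|u (k + N)%N| <= 2^-1 ^+ k.
Proof.
move=> uN k; apply: le_trans (uN _ (leq_addl _ _)) _.
by rewrite exprD ler_piMr ?exprn_ge0 ?invr_ge0// exprn_ile1 ?invr_ge0//; lra.
Qed.

Lemma rapid_cvg (u : R^nat) : rapid u -> cvgn (series u).
Proof.
move=> [N /rapid_shift uN]; apply/cvg_ex; eexists; apply: (cvg_series_shift (N := N)).
exact: abs_le_cvg geometric_half_cvg.
Qed.

(** A rapidly decreasing sequence of smooth functions on B: from some index on,
which may depend on the order of differentiation, each derivative is dominated
by a geometric sequence uniformly on B. *)
Definition rapid_on B (F : nat -> 'rV[R]_n -> R) :=
  (forall k, smooth_on B (F k)) /\
  forall s, exists N, forall k, (N <= k)%N -> forall y, B y ->
    `|iter_pderiv s (F k) y| <= 2^-1 ^+ k.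

Lemma rapid_on_pderiv B F i : rapid_on B F ->
  rapid_on B (fun k => pderiv i (F k)).
Proof.
move=> [sF bF]; split=> [k|s]; first exact: smooth_pderiv.
have [N FN] := bF (rcons s i); exists N => k Nk y By.
by have := FN k Nk y By; rewrite /iter_pderiv -cats1 foldr_cat.
Qed.

Lemma rapid_on_iter_pderiv B F s : rapid_on B F ->
  rapid_on B (fun k => iter_pderiv s (F k)).
Proof. by move=> rF; elim: s => //= i s /rapid_on_pderiv. Qed.

Lemma rapid_on_rapid B F y : rapid_on B F -> B y -> rapid (fun k => F k y).
Proof. by move=> [_ /(_ [::])[N FN]] By; exists N => k /FN; exact. Qed.

Definition convex_set B := forall x y (s : R), 0 <= s <= 1 -> B x -> B y ->
  B (x + s *: (y - x)).

(** Two applications of the mean value theorem on segments. The bound depends on f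
only through c, so that it survives summation over a series of functions. *)
Lemma quadratic_remainder B f y h (c : R) : convex_set B ->
  smooth_on B f -> (forall i j z, B z -> `|pderiv i (pderiv j f) z| <= c) ->
  B y -> B (y + h) ->
  `|f (y + h) - f y - \sum_i h 0 i * pderiv i f y| <= n%:R ^+ 2 * c * `|h| ^+ 2.
Proof.
move=> cB sf bf By Byh.
have Bs s : 0 <= s <= 1 -> B (y + s *: h).
  by move=> s01; have := cB _ _ _ s01 By Byh; rewrite [y + h]addrC addrK.
have [s /Bs Bsy|s s01 ->] := @MVT_line f y h.
  exact: smooth_differentiable sf Bsy.
rewrite -sumrB; apply: le_trans (ler_norm_sum _ _ _) _.
have dp i : `|pderiv i f (y + s *: h) - pderiv i f y| <= n%:R * c * `|h|.
  have [t /andP[t0 t1]|t /andP[t0 t1] ->] := @MVT_line (pderiv i f) y (s *: h).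
    apply: (@smooth_differentiable _ _ B); first exact: smooth_pderiv.
    rewrite scalerA; apply: Bs; case/andP: s01 => s0 s1.
    by rewrite mulr_ge0//= mulr_ile1.
  apply: le_trans (ler_norm_sum _ _ _) _.
  rewrite -mulrA mulr_natl -[X in _ <= _ *+ X]card_ord -sumr_const.
  apply: ler_sum => j _; rewrite normrM mulrC ler_pM//.
    apply: bf; rewrite scalerA; apply: Bs; case/andP: s01 => s0 s1.
    by rewrite mulr_ge0//= mulr_ile1.
  rewrite mxE normrM; case/andP: s01 => s0 s1.
  rewrite ger0_norm// -[leRHS]mul1r ler_pM//; exact: norm_entry.
rewrite expr2 -!mulrA mulr_natl -[X in _ <= _ *+ X]card_ord -sumr_const.
apply: ler_sum => i _; rewrite -mulrBr normrM mulrC expr2 !mulrA ler_pM//.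
exact: norm_entry.
Qed.

End Calculus.

Section LinForm.
Context {R : realType} {n : nat}.

(** The candidate for a differential with prescribed partial derivatives. *)
Definition lin_form (D : 'I_n -> R) (h : 'rV[R]_n) : R := \sum_i h 0 i * D i.

Lemma lin_form_linear D : linear (lin_form D : 'rV[R]_n -> R^o).
Proof.
move=> a u v; rewrite /lin_form scaler_sumr -big_split /=.
by apply: eq_bigr => i _; rewrite !mxE mulrDl -mulrA.
Qed.

HB.instance Definition _ D :=
  GRing.isLinear.Build R 'rV[R]_n R^o _ (lin_form D) (lin_form_linear D).

Lemma lin_form_continuous D : continuous (lin_form D).
Proof.
move=> h; apply: (@differentiable_continuous R 'rV[R]_n R^o).
rewrite (_ : lin_form D = \sum_i (fun h : 'rV[R]_n => h 0 i * D i)); last first.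
  by apply/funext => k; rewrite fct_sumE.
apply: differentiable_sum => i; apply: differentiableM => //.
exact: differentiable_coord.
Qed.

Lemma lin_form_delta D i : lin_form D (delta_mx 0 i) = D i.
Proof.
rewrite /lin_form (bigD1 i)//= big1 ?addr0; first by rewrite mxE !eqxx mul1r.
by move=> j /negbTE ji; rewrite mxE ji mul0r.
Qed.

End LinForm.

Section Termwise.
Context {R : realType} {n : nat}.
Implicit Types (f g : 'rV[R]_n -> R) (U B : set 'rV[R]_n) (y v : 'rV[R]_n).

Definition fseries (F : nat -> 'rV[R]_n -> R) : 'rV[R]_n -> R :=
  fun y => limn (series (fun k => F k y)).

Let q : R := 2^-1.

(** The remainders of order two of the terms sum to a remainder of order two. *)
Lemma fseries_dominated B F y : open B -> convex_set B -> B y ->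
  (forall k, smooth_on B (F k)) ->
  (forall k z, B z -> `|F k z| <= q ^+ k) ->
  (forall k i, `|pderiv i (F k) y| <= q ^+ k) ->
  (forall k i j z, B z -> `|pderiv i (pderiv j (F k)) z| <= q ^+ k) ->
  differentiable (fseries F) y /\
  forall i, pderiv i (fseries F) y = limn (series (fun k => pderiv i (F k) y)).
Proof.
move=> oB cB By sF b0 b1 b2.
pose D i := limn (series (fun k => pderiv i (F k) y)).
pose W : R := limn (series (fun k => q ^+ k)).
have cW : cvgn (series (fun k => q ^+ k : R)) := geometric_half_cvg.
have W0 : 0 <= W.
  apply: le_trans (normr_ge0 (limn (series (fun=> 0 : R)))) _.
  by apply: abs_le_lim cW => k; rewrite normr0 exprn_ge0// invr_ge0.
have cF z : B z -> cvgn (series (fun k => F k z)).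
  by move=> Bz; apply: abs_le_cvg cW => k; exact: b0.
have cD i : cvgn (series (fun k => pderiv i (F k) y)).
  by apply: abs_le_cvg cW => k; exact: b1.
have est h : B (y + h) ->
    `|fseries F (h + y) - fseries F y - lin_form D h| <= n%:R ^+ 2 * W * `|h| ^+ 2.
  move=> Byh.
  have E1 : series (fun k => F k (y + h) - F k y - \sum_i h 0 i * pderiv i (F k) y)
      @ \oo --> fseries F (h + y) - fseries F y - lin_form D h.
    have -> : series (fun k => F k (y + h) - F k y - \sum_i h 0 i * pderiv i (F k) y)
      = (fun m => series (fun k => F k (y + h)) m - series (fun k => F k y) m -
          \sum_i h 0 i * series (fun k => pderiv i (F k) y) m).
      apply/funext => m; rewrite /series /= !sumrB; congr (_ - _).
      by rewrite exchange_big /=; apply: eq_bigr => i _; rewrite mulr_sumr.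
    apply: cvgB; first by rewrite [h + y]addrC; apply: cvgB; exact: cF.
    apply: cvg_sumr => i; apply: cvgMl_tmp; exact: cD.
  rewrite -(cvg_lim _ E1)//.
  have bW k : `|F k (y + h) - F k y - \sum_i h 0 i * pderiv i (F k) y| <=
      (n%:R ^+ 2 * `|h| ^+ 2) * q ^+ k.
    apply: le_trans (quadratic_remainder cB (sF k) _ By Byh) _.
      by move=> i j z; exact: b2.
    by rewrite le_eqVlt; apply/orP; left; apply/eqP; ring.
  have cW' : cvgn (series (fun k => (n%:R ^+ 2 * `|h| ^+ 2) * q ^+ k : R)).
    exact: (@is_cvg_seriesZ _ _ (n%:R ^+ 2 * `|h| ^+ 2) cW).
  apply: le_trans (abs_le_lim bW cW') _.
  rewrite (_ : (fun k => _) = (n%:R ^+ 2 * `|h| ^+ 2) *: (fun k => q ^+ k))//.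
  rewrite lim_seriesZ// /GRing.scale /= -/W.
  by rewrite le_eqVlt; apply/orP; left; apply/eqP; ring.
have [] := @differentiable_estimate _ _ _ (fseries F) (lin_form D : {linear _ -> R^o}) y.
- exact: lin_form_continuous.
- move=> e e0; have /nbhs_ballP[r /= r0 rB] : nbhs y B by exact: open_nbhs_nbhs.
  pose C := n%:R ^+ 2 * W + 1.
  have C0 : 0 < C by rewrite ltr_wpDl// mulr_ge0.
  apply/nbhs_ballP; exists (Num.min r (e / C)).
    by rewrite /= lt_min r0 divr_gt0.
  move=> h; rewrite -ball_normE /= sub0r normrN lt_min => /andP[hr he].
  apply: le_trans (est _ _) _.
    apply: rB; rewrite -ball_normE /= opprD addrA subrr sub0r normrN.
    exact: hr.
  rewrite expr2 mulrA ler_wpM2r//.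
  move: he; rewrite ltr_pdivlMr// => /ltW; apply: le_trans.
  by rewrite mulrC ler_wpM2l// /C lerDl.
- move=> dS dSE; split=> // i.
  by rewrite pderivE// dSE; exact: lin_form_delta.
Qed.

(** The finitely many terms for which the bounds of order at most two may fail are
split off as a finite sum. *)
Lemma fseries_derive B F y : open B -> convex_set B -> rapid_on B F -> B y ->
  differentiable (fseries F) y /\
  forall i, pderiv i (fseries F) y = fseries (fun k => pderiv i (F k)) y.
Proof.
move=> oB cB rF By; have [sF bF] := rF.
have [N FN] := choice bF.
pose M := (N [::] + \max_i N [:: i] + \max_i \max_j N [:: i; j])%N.
have MN0 k : (N [::] <= k + M)%N.
  by rewrite /M -addnA addnCA leq_addr.
have MN1 k i : (N [:: i] <= k + M)%N.
  apply: leq_trans (@leq_bigmax _ (fun i => N [:: i]) i) _.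
  by rewrite /M -!addnA [X in (_ <= k + X)%N]addnCA addnCA leq_addr.
have MN2 k i j : (N [:: i; j] <= k + M)%N.
  apply: leq_trans (@leq_bigmax _ (fun j => N [:: i; j]) j) _.
  apply: leq_trans (@leq_bigmax _ (fun i => \max_j N [:: i; j]) i) _.
  by rewrite /M addnA leq_addl.
have qM k : q ^+ (k + M) <= q ^+ k.
  by rewrite exprD ler_piMr ?exprn_ge0 ?invr_ge0// exprn_ile1 ?invr_ge0// /q; lra.
pose T := fseries (fun k => F (k + M)%N).
pose P z := \sum_(k < M) F k z.
have SE z : B z -> fseries F z = P z + T z.
  move=> Bz; apply/cvg_lim => //.
  rewrite /P -(big_mkord xpredT (fun k => F k z)).
  apply: (@cvg_series_shift _ (fun k => F k z)).
  apply: abs_le_cvg geometric_half_cvg => k.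
  exact: le_trans (FN _ _ (MN0 k) _ Bz) (qM k).
have [| | |k|k z Bz|k i|k i j z Bz|dT pT] := @fseries_dominated B (fun k => F (k + M)%N) y => //.
- exact: le_trans (FN _ _ (MN0 k) _ Bz) (qM k).
- exact: le_trans (FN _ _ (MN1 k i) _ By) (qM k).
- exact: le_trans (FN _ _ (MN2 k i j) _ Bz) (qM k).
have dF (k : 'I_M) : differentiable (F k) y by exact: smooth_differentiable (sF k) By.
have PE : P = \sum_(k < M) F k by apply/funext => z; rewrite /P fct_sumE.
have dP : differentiable P y by rewrite PE; exact: differentiable_sum.
have nS : \forall z \near y, (P \+ T) z = fseries F z.
  by apply: open_near oB By _ => z /SE.
split.
  apply: near_eq_differentiable nS _; exact: differentiableD.
move=> i; rewrite -(near_eq_pderiv i nS) pderivD// pT.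
apply/esym/cvg_lim => //.
have -> : pderiv i P y = \sum_(k < M) pderiv i (F k) y.
  by rewrite PE (pderiv_sum i (F := fun k : 'I_M => F k)).
rewrite -(big_mkord xpredT (fun k => pderiv i (F k) y)).
apply: (@cvg_series_shift _ (fun k => pderiv i (F k) y)).
apply: abs_le_cvg geometric_half_cvg => k.
exact: le_trans (FN _ _ (MN1 k i) _ By) (qM k).
Qed.

Lemma fseries_smooth B F : open B -> convex_set B -> rapid_on B F ->
  smooth_on B (fseries F).
Proof.
move=> oB cB rF; pose P h := exists2 G, rapid_on B G & h = fseries G.
apply: (@generated_smooth _ _ B P oB); last by apply: gen_base; exists F.
- by move=> _ [G rG ->] y By; have [] := fseries_derive oB cB rG By.
- move=> _ i [G rG ->]; have rG' := rapid_on_pderiv i rG.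
  apply: gen_ext (gen_base _ _); last by exists (fun k => pderiv i (G k)).
  by move=> y By; have [_ ->] := fseries_derive oB cB rG By.
Qed.

Lemma fseries_iter_pderiv B F s y : open B -> convex_set B -> rapid_on B F ->
  B y -> iter_pderiv s (fseries F) y = fseries (fun k => iter_pderiv s (F k)) y.
Proof.
move=> oB cB rF; elim: s y => //= i s IH y By.
rewrite (near_eq_pderiv i (open_near oB By IH)).
by have [_ ->] := fseries_derive oB cB (rapid_on_iter_pderiv s rF) By.
Qed.

End Termwise.

(** * Calibrated planes in linear algebra *)

Section Alternating.
Context {R : realType} {n p : nat}.
Implicit Types (V : 'M[R]_(p, n)) (u : 'rV[R]_n) (i : 'I_p) (w : 'M[R]_(p, n) -> R).

Lemma row_replace_row i u V : row i (replace_row i u V) = u.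
Proof. by apply/rowP => j; rewrite !mxE eqxx. Qed.

Lemma row_replace_row_neq i k u V : k != i -> row k (replace_row i u V) = row k V.
Proof. by move=> /negbTE ki; apply/rowP => j; rewrite !mxE ki mxE. Qed.

Lemma row'_replace_row i u V : row' i (replace_row i u V) = row' i V.
Proof. by apply/matrixP => j k; rewrite !mxE eq_sym (negbTE (neq_lift _ _)) mxE. Qed.

Lemma replace_row_id i V : replace_row i (row i V) V = V.
Proof. by apply/row_matrixP => k; rewrite rowK; case: eqP => // ->. Qed.

Lemma alt_replaceD w i (a b : R) u u' V : alternating_multilinear w ->
  w (replace_row i (a *: u + b *: u') V) =
  a * w (replace_row i u V) + b * w (replace_row i u' V).
Proof.
move=> [ml _]; apply: (ml _ _ _ i); first by rewrite !row_replace_row.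
  by rewrite !row'_replace_row.
by rewrite !row'_replace_row.
Qed.

Lemma alt_replace0 w i V : alternating_multilinear w -> w (replace_row i 0 V) = 0.
Proof.
move=> aw; have := alt_replaceD i 0 0 0 0 V aw.
by rewrite !scale0r addr0 !mul0r addr0.
Qed.

Lemma alt_replaceZ w i (a : R) u V : alternating_multilinear w ->
  w (replace_row i (a *: u) V) = a * w (replace_row i u V).
Proof.
by move=> aw; rewrite -[a *: u]addr0 -(scale0r 0) alt_replaceD// mul0r addr0.
Qed.

Lemma alt_replace_sum w i k (a : 'I_k -> R) (u : 'I_k -> 'rV[R]_n) V :
  alternating_multilinear w ->
  w (replace_row i (\sum_j a j *: u j) V) = \sum_j a j * w (replace_row i (u j) V).
Proof.
move=> aw; apply: (big_ind2 (fun x y => w (replace_row i x V) = y)).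
- exact: alt_replace0.
- move=> x y z t <- <-.
  by rewrite -[x in LHS]scale1r -[z in LHS]scale1r alt_replaceD// !mul1r.
- by move=> j _; exact: alt_replaceZ.
Qed.

Lemma alt_replace_row_eq w i j V : alternating_multilinear w -> i != j ->
  w (replace_row i (row j V) V) = 0.
Proof.
move=> [_ alt] ij; apply: (alt _ i j ij).
by rewrite row_replace_row row_replace_row_neq// eq_sym.
Qed.

(** The hybrids interpolate between L *m V and V one row at a time, the rows of
index at least k being already transformed; a lower triangular L makes each
transformed row a combination of rows still present. *)
Lemma alt_trig w (L : 'M[R]_p) V : alternating_multilinear w -> is_trig_mx L ->
  w (L *m V) = \det L * w V.
Proof.
move=> aw tL; rewrite det_trig//; move/is_trig_mxP in tL.
pose H k : 'M[R]_(p, n) := \matrix_(i < p) if (i < k)%N then row i V else row i (L *m V).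
have Hp : H p = V by apply/row_matrixP => i; rewrite rowK ltn_ord.
have H0 : H 0%N = L *m V by apply/row_matrixP => i; rewrite rowK.
have step (k : 'I_p) : w (H k) = L k k * w (H k.+1).
  have -> : H k = replace_row k (\sum_j L k j *: row j V) (H k.+1).
    apply/row_matrixP => i; rewrite !rowK ltnS; have [->|ik] := eqVneq i k.
      by rewrite ltnn row_mul mulmx_sum_row; apply: eq_bigr => j _; rewrite mxE.
    by rewrite [(i <= k)%N]leq_eqVlt -val_eqE /= in ik *; rewrite (negbTE ik).
  rewrite alt_replace_sum// (bigD1 k)//= big1 ?addr0.
    congr (_ * w _); apply/row_matrixP => i; rewrite !rowK.
    by case: eqP => // ->; rewrite ltnS leqnn.
  move=> j jk; have [lt_kj|le_jk] := ltnP k j; first by rewrite tL// mul0r.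
  have -> : row j V = row j (H k.+1) by rewrite rowK ltnS le_jk.
  by rewrite alt_replace_row_eq ?mulr0// eq_sym.
have main k : (k <= p)%N -> w (H 0%N) = (\prod_(i < p | (i < k)%N) L i i) * w (H k).
  elim: k => [_|k IH kp]; first by rewrite big_pred0 ?mul1r.
  rewrite IH ?(ltnW kp)// (step (Ordinal kp)) mulrA; congr (_ * _).
  rewrite (bigD1 (Ordinal kp) (P := fun i : 'I_p => (i < k.+1)%N))//= mulrC.
  congr (_ * _); apply: eq_bigl => i; rewrite -val_eqE /= ltnS.
  by rewrite [(i < k)%N]ltn_neqAle andbC.
rewrite -H0 (main p)// Hp; congr (_ * _); apply: eq_bigl => i.
by rewrite ltn_ord.
Qed.

End Alternating.

Section Cholesky.
Context {R : realType}.

Definition posdef k (S : 'M[R]_k) :=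
  S^T = S /\ forall x : 'rV[R]_k, x != 0 -> 0 < (x *m S *m x^T) 0 0.

(** Cholesky factorization, by recursion on the Schur complement. Its triangular
shape is what alt_trig asks for. *)
Lemma cholesky k (S : 'M[R]_k) : posdef S ->
  exists L : 'M[R]_k, [/\ is_trig_mx L, 0 < \det L & L *m S *m L^T = 1%:M].
Proof.
elim: k S => [|k IH] S [symS posS].
  exists 0; split; first by apply/is_trig_mxP => -[].
    by rewrite det_mx00.
  by apply/matrixP => -[].
rewrite -[k.+1]/(1 + k)%N in S symS posS *.
pose a := ulsubmx S; pose b := ursubmx S; pose D := drsubmx S.
have SE : S = block_mx a b b^T D.
  rewrite -[S in LHS]submxK; congr block_mx.
  by rewrite -[in LHS]symS -trmx_ursub.
set r := a 0 0.
have aE : a = r%:M by rewrite [LHS]mx11_scalar.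
have r0 : 0 < r.
  have /posS : row_mx 1%:M 0 != 0 :> 'rV[R]_(1 + k)%N.
    apply/eqP => /(congr1 (fun M : 'M[R]_(1, (1 + k)%N) => lsubmx M 0 0)).
    by rewrite row_mxKl !mxE => /eqP; rewrite oner_eq0.
  rewrite SE mul_row_block !mul1mx !mul0mx !addr0 tr_row_mx trmx1 trmx0.
  by rewrite mul_row_col mulmx1 mulmx0 addr0.
have rn0 : r != 0 by rewrite gt_eqF.
have aK q (M : 'M[R]_(q, 1)) : - r^-1 *: M *m a = - M.
  by rewrite aE mul_mx_scalar scalerA mulrN divff// scaleN1r.
pose D' := D - r^-1 *: (b^T *m b).
have posD' : posdef D'.
  split.
    rewrite /D' linearB /= linearZ /= trmx_mul trmxK; congr (_ - _).
    by rewrite /D -[in RHS]symS trmx_drsub.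
  move=> y y0; have /posS : row_mx (- r^-1 *: (y *m b^T)) y != 0 :> 'rV[R]_(1 + k)%N.
    apply: contra y0 => /eqP /(congr1 rsubmx); rewrite row_mxKr => ->.
    by apply/eqP/matrixP => i j; rewrite !mxE.
  rewrite SE mul_row_block aK addNr tr_row_mx mul_row_col mul0mx add0r.
  suff -> : y *m D' = - r^-1 *: (y *m b^T) *m b + y *m D by [].
  by rewrite mulmxBr -scalemxAr mulmxA scaleNr mulNmx -scalemxAl addrC.
have [P [tP dP PP]] := IH _ posD'.
pose s := (Num.sqrt r)^-1.
have s0 : 0 < s by rewrite invr_gt0 sqrtr_gt0.
have ssr : s * s * r = 1.
  by rewrite -expr2 exprVn sqr_sqrtr ?ltW// mulVf.
exists (block_mx s%:M 0 (- r^-1 *: (P *m b^T)) P); split.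
- by rewrite is_trig_block_mx// eqxx tP andbT scalar_mx_is_trig.
- by rewrite det_lblock det_scalar1 mulr_gt0.
- rewrite SE mulmx_block tr_block_mx aK !mul0mx !addr0 addNr mulmx_block.
  rewrite !mul0mx !add0r trmx0 mulmx0 addr0 tr_scalar_mx.
  rewrite mulmx0 scalar_mx_block -PP; congr block_mx.
  + by rewrite aE -!scalar_mxM mulrAC ssr.
  + rewrite linearZ /= trmx_mul trmxK aE -scalar_mxM -scalemxAr -!mulmxA.
    rewrite !mul_scalar_mx scalerA mulrCA mulNr mulVf// mulrN1 scaleNr.
    by rewrite addNr.
  + suff -> : P *m D' = - r^-1 *: (P *m b^T) *m b + P *m D by [].
    by rewrite mulmxBr -scalemxAr mulmxA scaleNr mulNmx -scalemxAl addrC.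
Qed.

End Cholesky.

Section Comass.
Context {R : realType} {n p : nat}.
Variables (G : 'M[R]_n) (w : 'M[R]_(p, n) -> R).
Hypotheses (symG : G^T = G) (w_alt : alternating_multilinear w) (p_ge1 : (1 <= p)%N).
Hypothesis comass_le1 : forall V, Num.sqrt (\det (V *m G *m V^T)) = 1 -> w V <= 1.
Implicit Types (V : 'M[R]_(p, n)) (u : 'rV[R]_n) (i : 'I_p).

Let gram V := V *m G *m V^T.

Lemma gram_mul (L : 'M[R]_p) V : gram (L *m V) = L *m gram V *m L^T.
Proof. by rewrite /gram trmx_mul !mulmxA. Qed.

(** The bound on unit planes extends by scaling one row. *)
Lemma comass_le V : 0 < \det (gram V) -> w V <= Num.sqrt (\det (gram V)).
Proof.
move=> V0; set N := Num.sqrt _; have N0 : 0 < N by rewrite sqrtr_gt0.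
pose i := Ordinal p_ge1.
pose d := \row_k (if k == i then N^-1 else 1) : 'rV[R]_p.
have dd : \det (diag_mx d) = N^-1.
  rewrite det_diag (bigD1 i)//= big1 ?mulr1; first by rewrite mxE eqxx.
  by move=> k /negbTE ki; rewrite mxE ki.
have wd : w (diag_mx d *m V) = N^-1 * w V.
  by rewrite alt_trig ?dd//; apply/is_diag_mx_is_trig/diag_mx_is_diag.
rewrite -[leRHS]mulr1 -ler_pdivrMl// -wd; apply: comass_le1.
rewrite -/(gram _) gram_mul !det_mulmx det_tr dd.
rewrite (_ : \det (gram V) = N * N); last by rewrite -expr2 sqr_sqrtr// ltW.
by rewrite -mulrA mulfK ?gt_eqF// mulVf ?gt_eqF// sqrtr1.
Qed.

(** Orthogonality kills the cross terms, so that only one diagonal entry moves, and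
only to second order in t. *)
Lemma gram_perturb V u i (t : R) : u *m G *m V^T = 0 ->
  gram (replace_row i (row i V + t *: u) V) =
  gram V + (t ^+ 2 * (u *m G *m u^T) 0 0) *: delta_mx i i.
Proof.
move=> uV.
have Vu : V *m G *m u^T = 0.
  by apply: trmx_inj; rewrite trmx0 !trmx_mul trmxK symG mulmxA.
have -> : replace_row i (row i V + t *: u) V = V + t *: (delta_mx i 0 *m u).
  apply/row_matrixP => k; rewrite rowK linearD linearZ /= row_mul.
  have -> : row k (delta_mx i 0 : 'cV[R]_p) = (k == i)%:R%:M.
    by apply/rowP => j; rewrite !ord1 !mxE eqxx andbT mulr1n.
  rewrite mul_scalar_mx; case: eqP => [->|_]; first by rewrite scale1r.
  by rewrite scale0r scaler0 addr0.
set c := (u *m G *m u^T) 0 0; set d : 'cV[R]_p := delta_mx i 0.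
have cE : u *m G *m u^T = c%:M by rewrite [LHS]mx11_scalar.
have E1 : (V + t *: (d *m u)) *m G *m V^T = gram V.
  rewrite !mulmxDl -!scalemxAl -!mulmxA [u *m (G *m _)]mulmxA uV mulmx0 scaler0.
  by rewrite addr0 mulmxA.
rewrite {1}/gram linearD mulmxDr /= E1; congr (_ + _).
rewrite linearZ /= trmx_mul -scalemxAr !mulmxDl -!scalemxAl !mulmxA Vu mul0mx.
rewrite add0r scalerA -expr2 -scalerA; congr (_ *: _).
have -> : d *m u *m G *m u^T *m d^T = d *m (u *m G *m u^T) *m d^T.
  by rewrite !mulmxA.
rewrite cE mul_mx_scalar -scalemxAl trmx_delta.
by rewrite mul_delta_mx.
Qed.

(** Moving one row of a plane where w attains its comass in a direction u
orthogonal to the plane increases the volume only to second order, so that w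
cannot increase to first order. *)
Lemma comass_max V u i : \det (gram V) = 1 -> w V = 1 -> u *m G *m V^T = 0 ->
  w (replace_row i u V) = 0.
Proof.
move=> gV wV uV; apply/eqP; apply: contraT => b0.
set b := w _ in b0.
pose c := (u *m G *m u^T) 0 0.
pose K := c * \det (replace_row i (delta_mx 0 i) (gram V)).
have detK t : \det (gram (replace_row i (row i V + t *: u) V)) = 1 + K * t ^+ 2.
  rewrite gram_perturb// (determinant_multilinear (i0 := i) (b := 1)
    (c := t ^+ 2 * c) (B := gram V) (C := replace_row i (delta_mx 0 i) (gram V))).
  - by rewrite gV mul1r /K; ring.
  - rewrite row_replace_row linearD linearZ /= scale1r; congr (_ + _ *: _).
    by apply/rowP => j; rewrite !mxE eqxx.
  - apply/matrixP => j k.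
    by rewrite !mxE [lift _ _ == _]eq_sym (negbTE (neq_lift _ _)) /= mulr0 addr0.
  - rewrite row'_replace_row; apply/matrixP => j k.
    by rewrite !mxE [lift _ _ == _]eq_sym (negbTE (neq_lift _ _)) /= mulr0 addr0.
have wt t : w (replace_row i (row i V + t *: u) V) = 1 + t * b.
  by rewrite -[row i V]scale1r alt_replaceD// replace_row_id wV mul1r.
(* With the displacement e * b, comass_le would give 2 <= e * (K - b ^+ 2), while
this choice of e makes the right hand side less than 1. *)
pose e := (`|K| + b ^+ 2 + 1)^-1.
have e0 : 0 < e by rewrite invr_gt0 ltr_wpDl// addr_ge0// sqr_ge0.
have eK : e * (`|K| + b ^+ 2) < 1.
  by rewrite mulrC ltr_pdivrMr ?mul1r ?ltrDl// -invr_gt0.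
have b2 : 0 < b ^+ 2 by rewrite exprn_even_gt0//= b0 orbT.
have K0 := normr_ge0 K; have K1 := ler_norm K; have K2 := lerNnormlW (lexx `|K|).
have D0 : 0 < 1 + K * (e * b) ^+ 2.
  have : `|K| * (e * b) ^+ 2 < 1.
    rewrite (_ : `|K| * (e * b) ^+ 2 = e * `|K| * (e * b ^+ 2)); last by ring.
    have X0 : 0 <= e * `|K| by rewrite mulr_ge0// ltW.
    have Y0 : 0 <= e * b ^+ 2 by rewrite mulr_ge0// ltW.
    rewrite mulrDr in eK.
    apply: le_lt_trans (_ : e * `|K| < 1); last by lra.
    by rewrite ler_piMr//; lra.
  have := sqr_ge0 (e * b); nra.
have := @comass_le (replace_row i (row i V + (e * b) *: u) V).
rewrite detK wt => /(_ D0); rewrite -(ler_pXn2r (n := 2))//; last 2 first.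
- by rewrite nnegrE addr_ge0// -mulrA -expr2 mulr_ge0// ?ltW.
- by rewrite nnegrE sqrtr_ge0.
rewrite sqr_sqrtr; last exact: ltW.
move=> H.
have T0 : 0 < e * b ^+ 2 by rewrite mulr_gt0.
have eK1 : e * K < 1.
  apply: le_lt_trans eK; rewrite ler_pM2l//; apply: le_trans K1 _.
  by rewrite lerDl ltW.
have E1 : (1 + e * b * b) ^+ 2 = (1 + e * b ^+ 2) ^+ 2 by ring.
have E2 : K * (e * b) ^+ 2 = (e * K) * (e * b ^+ 2) by ring.
rewrite E1 E2 in H; move: (e * b ^+ 2) (e * K) T0 eK1 H => T k T0 k1 H.
by have := mulr_gt0 T0 (_ : 0 < 1 - k); rewrite subr_gt0 => /(_ k1); nra.
Qed.

(** Only the component of v_i T along the plane contributes to the i-th term, by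
comass_max, and in that component only the multiple of v_i, because w alternates:
the sum is the trace of the compression of T to the plane. *)
Lemma comass_trace V (T : 'M[R]_n) : \det (gram V) = 1 -> w V = 1 ->
  \sum_i w (replace_row i (row i V *m T) V) =
  \tr (V *m (T *m G) *m V^T *m invmx (gram V)).
Proof.
move=> gV wV; have uS : gram V \in unitmx by rewrite unitmxE gV unitr1.
(* The rows of C are the coordinates of the orthogonal projections of the v_i T. *)
set C := _ *m invmx _.
have CE i : row i V *m T = \sum_j C i j *: row j V + row i (V *m T - C *m V).
  rewrite linearB /= row_mul row_mul [row i C *m V]mulmx_sum_row addrC.
  rewrite (eq_bigr (fun j => C i j *: row j V)) ?subrK// => j _.
  by rewrite mxE.
rewrite /mxtrace; apply: eq_bigr => i _.
rewrite CE -[X in replace_row _ (X + _)]scale1r -[row i (_ - _)]scale1r.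
rewrite alt_replaceD// mul1r [1 * w _]mul1r [X in _ + X]comass_max// ?addr0; last first.
  rewrite -!row_mul !mulmxBl -[C *m V *m G]mulmxA -[C *m _ *m V^T]mulmxA -/(gram V).
  by rewrite mulmxKV// !mulmxA subrr row0.
rewrite alt_replace_sum// (bigD1 i)//= big1 ?addr0; first by rewrite replace_row_id wV mulr1.
by move=> j ji; rewrite alt_replace_row_eq ?mulr0// eq_sym.
Qed.

End Comass.

(** * The Hessian of a function *)

Section SmoothMatrix.
Context {R : realType} {n : nat}.
Implicit Types (U : set 'rV[R]_n).

Lemma smooth_bigsum (I : Type) (r : seq I) (P : pred I) U (F : I -> 'rV[R]_n -> R) :
  open U -> (forall i, smooth_on U (F i)) ->
  smooth_on U (fun y => \sum_(i <- r | P i) F i y).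
Proof.
move=> oU sF; elim: r => [|i r IH].
  by apply: smooth_ext (smooth_cst 0 oU) => // y _; rewrite big_nil.
case Pi : (P i).
  by apply: smooth_ext (smoothD oU (sF i) IH) => // y _; rewrite big_cons Pi.
by apply: smooth_ext IH => // y _; rewrite big_cons Pi.
Qed.

Lemma smooth_bigprod (I : Type) (r : seq I) U (F : I -> 'rV[R]_n -> R) :
  open U -> (forall i, smooth_on U (F i)) ->
  smooth_on U (fun y => \prod_(i <- r) F i y).
Proof.
move=> oU sF; elim: r => [|i r IH].
  by apply: smooth_ext (smooth_cst 1 oU) => // y _; rewrite big_nil.
by apply: smooth_ext (smoothM oU (sF i) IH) => // y _; rewrite big_cons.
Qed.

Lemma smooth_det U k (A : 'rV[R]_n -> 'M[R]_k) : open U ->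
  (forall i j, smooth_on U (fun y => A y i j)) -> smooth_on U (fun y => \det (A y)).
Proof.
move=> oU sA; rewrite /determinant; apply: smooth_bigsum => // s.
apply: (@smoothM _ _ U (cst _)) => //; first exact: smooth_cst.
exact: smooth_bigprod.
Qed.

Lemma smooth_invmx U k (A : 'rV[R]_n -> 'M[R]_k) i j : open U ->
  (forall i j, smooth_on U (fun y => A y i j)) ->
  (forall y, U y -> A y \in unitmx) -> smooth_on U (fun y => invmx (A y) i j).
Proof.
move=> oU sA uA.
have dA := smooth_det oU sA.
have dn0 y : U y -> \det (A y) != 0 by move=> /uA; rewrite unitmxE unitfE.
have sC : smooth_on U (fun y => cofactor (A y) j i).
  rewrite /cofactor; apply: (@smoothM _ _ U (cst _)) => //; first exact: smooth_cst.
  apply: smooth_det => // a b.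
  by apply: smooth_ext (sA (lift j a) (lift i b)) => // y _; rewrite !mxE.
apply: smooth_ext (smoothM oU (smooth_inv oU dn0 dA) sC) => // y Uy.
by rewrite /invmx uA// !mxE.
Qed.

End SmoothMatrix.

Section Hessian.
Context {R : realType} {n : nat} {X : topologicalType}.
Variables (S : smooth_structure R n X) (g : riemannian_metric S).
Implicit Types (c : chart R n X) (y v : 'rV[R]_n) (f : X -> R).

Lemma open_cod c : open (cod c).
Proof. exact: cod_open. Qed.
Arguments open_cod c : clear implicits.

Definition local_expr c f : 'rV[R]_n -> R := fun z => f (param c z).

(** The covariant Hessian of f, read in the chart c. *)
Definition hessian f c y : 'M[R]_n := \matrix_(i, j)
  (pderiv i (pderiv j (local_expr c f)) y
   - \sum_k christoffel g c y k i j * pderiv k (local_expr c f) y).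

Lemma smooth_local c f : atlas S c -> smooth_function S f ->
  smooth_on (cod c) (local_expr c f).
Proof. by move=> Sc sf; exact: sf. Qed.

Lemma smooth_invmetric c i j : atlas S c ->
  smooth_on (cod c) (fun y => invmx (metric g c y) i j).
Proof.
move=> Sc; apply: smooth_invmx; first exact: cod_open.
  exact: metric_smooth.
by move=> y; exact: metric_unitmx.
Qed.

Lemma smooth_gradient c f : atlas S c -> smooth_on (cod c) (local_expr c f) ->
  smooth_map_on (cod c) (gradient g f c).
Proof.
move=> Sc sf k; have oc := open_cod c.
apply: (smooth_ext oc (f := fun y => \sum_i pderiv i (local_expr c f) y *
  invmx (metric g c y) i k)).
  by move=> y _; rewrite !mxE; apply: eq_bigr => i _; rewrite mxE.
apply: smooth_sum => // i; apply: smoothM => //; first exact: smooth_pderiv.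
exact: smooth_invmetric.
Qed.

Lemma smooth_christoffel c k i j : atlas S c ->
  smooth_on (cod c) (fun y => christoffel g c y k i j).
Proof.
move=> Sc; have oc := open_cod c; have sg a b := metric_smooth g Sc a b.
apply: (@smoothM _ _ _ (cst _)) => //; first exact: smooth_cst.
apply: smooth_sum => // l; apply: smoothM => //; first exact: smooth_invmetric.
apply: smoothD => //; first by apply: smoothD => //; exact: smooth_pderiv.
apply: (smooth_ext oc _ (smoothM oc (smooth_cst (-1) oc) (smooth_pderiv l (sg i j)))).
by move=> y _ /=; rewrite mulN1r.
Qed.

Lemma smooth_hessian c f i j : atlas S c -> smooth_on (cod c) (local_expr c f) ->
  smooth_on (cod c) (fun y => hessian f c y i j).
Proof.
move=> Sc sf; have oc := open_cod c.
apply: (smooth_ext oc (f := pderiv i (pderiv j (local_expr c f)) \+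
  (cst (-1) \* (fun y => \sum_k christoffel g c y k i j * pderiv k (local_expr c f) y)))).
  by move=> y _; rewrite !mxE /= mulN1r.
apply: smoothD => //; first by do 2 apply: smooth_pderiv.
apply: smoothM => //; first exact: smooth_cst.
apply: smooth_sum => // k; apply: smoothM => //; first exact: smooth_christoffel.
exact: smooth_pderiv.
Qed.

(** The endomorphism v |-> nabla_v (grad f), acting on row vectors on the right. *)
Definition nabla_grad f c y : 'M[R]_n := 'J (gradient g f c) y +
  \matrix_(i, k) \sum_j christoffel g c y k i j * gradient g f c y 0 j.

Lemma covariant_derivativeE f c y v : atlas S c ->
  smooth_on (cod c) (local_expr c f) -> cod c y ->
  covariant_derivative g c (gradient g f c) y v = v *m nabla_grad f c y.
Proof.
move=> Sc sf cy; rewrite /covariant_derivative /nabla_grad mulmxDr.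
have dW := smooth_map_differentiable (smooth_gradient Sc sf) cy.
rewrite deriveEjacobian//; congr (_ + _); apply/rowP => k; rewrite !mxE.
apply: eq_bigr => i _; rewrite mxE mulr_sumr; apply: eq_bigr => j _; ring.
Qed.

Lemma gradient_metric f c y j : atlas S c -> cod c y ->
  \sum_k gradient g f c y 0 k * metric g c y k j = pderiv j (local_expr c f) y.
Proof.
move=> Sc cy.
have -> : \sum_k gradient g f c y 0 k * metric g c y k j =
    (gradient g f c y *m metric g c y) 0 j by rewrite mxE.
by rewrite /gradient mulmxKV ?metric_unitmx// mxE.
Qed.

(** Compatibility of the connection with the metric: differentiating the relation
\sum_k (grad f)_k g_kj = d_j f trades nabla (grad f) for second derivatives of f
and Christoffel symbols. *)
Lemma nabla_grad_metric f c y : atlas S c ->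
  smooth_on (cod c) (local_expr c f) -> cod c y ->
  nabla_grad f c y *m metric g c y = hessian f c y.
Proof.
move=> Sc sf cy; apply/matrixP => i j; rewrite !mxE.
have sW := smooth_gradient Sc sf.
have dW k := smooth_differentiable (sW k) cy.
have dG a b := smooth_differentiable (metric_smooth g Sc a b) cy.
set W := gradient g f c in sW dW *.
have E : pderiv i (pderiv j (local_expr c f)) y =
    \sum_k (W y 0 k * pderiv i (fun z => metric g c z k j) y
      + pderiv i (fun z => W z 0 k) y * metric g c y k j).
  rewrite -(near_eq_pderiv i (open_near (open_cod c) cy
    (fun z cz => gradient_metric f j Sc cz))).
  rewrite (_ : (fun z => _) = \sum_k (fun z => W z 0 k) \* (fun z => metric g c z k j)); last first.
    by apply/funext => z; rewrite fct_sumE.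
  rewrite pderiv_sum => [|k]; last exact: differentiableM.
  by apply: eq_bigr => k _; rewrite pderivM.
have -> : \sum_k nabla_grad f c y i k * metric g c y k j =
    \sum_k pderiv i (fun z => W z 0 k) y * metric g c y k j +
    \sum_k \sum_l christoffel g c y k i l * W y 0 l * metric g c y k j.
  rewrite -big_split /=; apply: eq_bigr => k _.
  rewrite /nabla_grad mxE jacobianE; last exact: smooth_map_differentiable sW cy.
  by rewrite mxE mulrDl mulr_suml.
have -> : \sum_k christoffel g c y k i j * pderiv k (local_expr c f) y =
    \sum_k \sum_l W y 0 k * christoffel g c y l i j * metric g c y k l.
  rewrite exchange_big /=; apply: eq_bigr => l _.
  rewrite -(gradient_metric f l Sc cy) mulr_sumr; apply: eq_bigr => k _.
  by rewrite mulrA [_ * W y 0 k]mulrC.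
rewrite E big_split /= addrAC -[RHS]addrC; congr (_ + _).
apply/eqP; rewrite eq_sym subr_eq; apply/eqP.
rewrite [X in X + _]exchange_big -big_split /=; apply: eq_bigr => k _.
rewrite christoffel_metric// mulr_sumr -big_split; apply: eq_bigr => l _.
by move: (christoffel g c y l i k) (christoffel g c y l i j) => a b /=; ring.
Qed.

End Hessian.
Arguments open_cod {R n X} c.

Section ChartChange.
Context {R : realType} {n : nat} {X : topologicalType}.
Variables (S : smooth_structure R n X) (g : riemannian_metric S).
Implicit Types (c : chart R n X) (y v : 'rV[R]_n) (f : X -> R).

Lemma dom_nbhs c x : dom c x -> nbhs x (dom c).
Proof. by move=> cx; apply: open_nbhs_nbhs; split => //; exact: dom_open. Qed.

Lemma open_overlap c c' : open (overlap c c').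
Proof.
rewrite openE => y [cy c'y].
have nc : nbhs y (cod c) by apply: open_nbhs_nbhs; split => //; exact: cod_open.
apply: filterI => //; apply: (param_continuous cy); exact: dom_nbhs.
Qed.

Lemma transition_param c c' y : overlap c c' y -> param c' (transition c c' y) = param c y.
Proof. by move=> [_ c'y]; exact: coordK. Qed.

Lemma transition_cod c c' y : overlap c c' y -> cod c' (transition c c' y).
Proof. by move=> [_ c'y]; exact: coord_cod. Qed.

Lemma overlap_coord c c' x : dom c x -> dom c' x -> overlap c c' (coord c x).
Proof. by move=> cx c'x; split; [exact: coord_cod|rewrite /= coordK]. Qed.

Lemma transition_coord c c' x : dom c x -> transition c c' (coord c x) = coord c' x.
Proof. by move=> cx; rewrite /transition coordK. Qed.

Lemma smooth_transition c c' : atlas S c -> atlas S c' ->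
  smooth_map_on (overlap c c') (transition c c').
Proof. by move=> Sc Sc'; have [] := atlas_compatible Sc Sc'. Qed.

Lemma local_transition c c' f z : overlap c c' z ->
  local_expr c f z = local_expr c' f (transition c c' z).
Proof. by move=> cc'z; rewrite /local_expr transition_param. Qed.

Section AtPoint.
Variables (c c' : chart R n X) (y : 'rV[R]_n).
Hypotheses (Sc : atlas S c) (Sc' : atlas S c') (cc'y : overlap c c' y).

Let tau := transition c c'.
Let J := 'J tau y.
Let oO : open (overlap c c') := @open_overlap c c'.
Let cy : cod c y. Proof. by case: cc'y. Qed.
Let c'y : cod c' (tau y). Proof. exact: transition_cod. Qed.

Let stau a : smooth_on (overlap c c') (fun z => tau z 0 a).
Proof. exact: smooth_transition. Qed.

Let dtau z : overlap c c' z -> differentiable tau z.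
Proof. exact: smooth_map_differentiable. Qed.

Let J_pderiv z i a : overlap c c' z -> 'J tau z i a = pderiv i (fun u => tau u 0 a) z.
Proof. by move=> /dtau; exact: jacobianE. Qed.

Let H i j a := pderiv i (pderiv j (fun u => tau u 0 a)) y.

Let H_sym i j a : H i j a = H j i a.
Proof.
have dd k := smooth_differentiable (smooth_pderiv k (stau a)) cc'y.
apply: pderivC => //; apply: open_near oO cc'y _ => z.
exact: smooth_differentiable (stau a).
Qed.

Lemma jacobian_unit : J \in unitmx.
Proof.
have := metric_unitmx g Sc cy; rewrite (metric_change g Sc Sc' cc'y).
by rewrite unitmx_mul unitmx_mul => /andP[/andP[]].
Qed.

Let G' := metric g c' (tau y).

Let G'_sym a b : G' a b = G' b a.
Proof. by rewrite /G' -[in LHS](metric_sym g Sc' c'y) mxE. Qed.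

Let G'_entry a b : smooth_on (cod c') (fun z => metric g c' z a b).
Proof. exact: metric_smooth. Qed.

Let dG' k i j := pderiv k (fun z => metric g c' z i j) (tau y).

(** The contraction of a trilinear form with three rows of the jacobian. *)
Let J3 i j k (N : 'I_n -> 'I_n -> 'I_n -> R) :=
  \sum_a \sum_b \sum_d J i a * J j b * J k d * N a b d.

Let A i j k := \sum_a \sum_b H i j a * G' a b * J k b.

Let pderiv_metric_change k i j :
  pderiv k (fun z => metric g c z i j) y =
  A k i j + A k j i + J3 i j k (fun a b d => dG' d a b).
Proof.
pose u a b z := pderiv i (fun s => tau s 0 a) z *
  metric g c' (tau z) a b * pderiv j (fun s => tau s 0 b) z.
have -> : pderiv k (fun z => metric g c z i j) y = pderiv k (fun z => \sum_a \sum_b u a b z) y.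
  apply: near_eq_pderiv; apply: open_near oO cc'y _ => z cc'z.
  rewrite (metric_change g Sc Sc' cc'z) mxE.
  under eq_bigr do rewrite mxE mulr_suml.
  rewrite exchange_big /=; apply: eq_bigr => a _; apply: eq_bigr => b _.
  by rewrite [in X in _ * X]mxE !J_pderiv.
have dJ a i0 : differentiable (pderiv i0 (fun s => tau s 0 a)) y.
  exact: smooth_differentiable (smooth_pderiv _ (stau a)) cc'y.
have dG a b : differentiable (fun z => metric g c' (tau z) a b) y.
  apply: (differentiable_compR (f := fun z => metric g c' z a b)); first exact: dtau.
  exact: smooth_differentiable (G'_entry a b) c'y.
have du a b : differentiable (u a b) y.
  by apply: differentiableM => //; exact: differentiableM.
have pu a b : pderiv k (u a b) y =
    H k i a * G' a b * J j b + J i a * G' a b * H k j b +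
    \sum_d J i a * J j b * J k d * dG' d a b.
  rewrite (pderivM k (f := (fun z => pderiv i (fun s => tau s 0 a) z *
    metric g c' (tau z) a b)))//; last exact: differentiableM.
  rewrite (pderivM k (f := pderiv i (fun s => tau s 0 a)))//.
  rewrite (pderiv_comp k (f := fun z => metric g c' z a b)); last 2 first.
  - exact: dtau.
  - exact: smooth_differentiable (G'_entry a b) c'y.
  rewrite -/(H k i a) -/(H k j b) -!J_pderiv// -/J -/G'.
  rewrite mulrDl addrA addrAC; congr (_ + _).
    by rewrite addrC; congr (_ + _); ring.
  rewrite mulr_sumr mulr_suml; apply: eq_bigr => d _.
  by rewrite -J_pderiv// -/J /dG'; ring.
rewrite (_ : (fun z => _) = \sum_a \sum_b u a b); last first.
  apply/funext => z; rewrite fct_sumE; apply: eq_bigr => a _.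
  by rewrite fct_sumE.
rewrite pderiv_sum => [|a]; last exact: differentiable_sum.
rewrite (eq_bigr (fun a => \sum_b pderiv k (u a b) y)); last first.
  by move=> a _; rewrite pderiv_sum.
rewrite (_ : A k j i = \sum_a \sum_b J i a * G' a b * H k j b); last first.
  rewrite /A exchange_big /=; apply: eq_bigr => a _; apply: eq_bigr => b _.
  by rewrite G'_sym; ring.
rewrite /A /J3 -!big_split /=; apply: eq_bigr => a _.
by rewrite -!big_split /=; apply: eq_bigr => b _; rewrite pu.
Qed.

Let J3_swap23 i j k N : J3 i k j N = J3 i j k (fun a b d => N a d b).
Proof.
rewrite /J3; apply: eq_bigr => a _; rewrite exchange_big /=.
by apply: eq_bigr => b _; apply: eq_bigr => d _; rewrite mulrAC; ring.
Qed.

Let J3_swap12 i j k N : J3 j i k N = J3 i j k (fun a b d => N b a d).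
Proof.
rewrite /J3 exchange_big /=.
by apply: eq_bigr => a _; apply: eq_bigr => b _; apply: eq_bigr => d _; ring.
Qed.

Let A_sym i j k : A i j k = A j i k.
Proof. by rewrite /A; apply: eq_bigr => a _; apply: eq_bigr => b _; rewrite H_sym. Qed.

(** The terms in the second derivatives of tau cancel in pairs, by symmetry, except
for one. *)
Let christoffel_lower_change i j k :
  \sum_l christoffel g c y l i j * metric g c y l k =
  A i j k + J3 i j k (fun a b d =>
     2^-1 * (dG' a b d + dG' b a d - dG' d a b)).
Proof.
rewrite christoffel_lower// !pderiv_metric_change.
rewrite (J3_swap23 j i k) (J3_swap12 i j k) (J3_swap23 i j k).
rewrite (A_sym j i) (A_sym k i) (A_sym k j).
have -> : J3 i j k (fun a b d => 2^-1 * (dG' a b d + dG' b a d - dG' d a b)) =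
    2^-1 * (J3 i j k (fun a b d => dG' a b d) + J3 i j k (fun a b d => dG' b a d)
      - J3 i j k (fun a b d => dG' d a b)).
  rewrite /J3 -sumrN -!big_split mulr_sumr; apply: eq_bigr => a _ /=.
  rewrite -sumrN -!big_split mulr_sumr; apply: eq_bigr => b _ /=.
  rewrite -sumrN -!big_split mulr_sumr; apply: eq_bigr => d _ /=.
  ring.
move: (J3 i j k _) (J3 i j k _) (J3 i j k _) (A _ _ _) (A _ _ _) (A _ _ _) => *.
by field.
Qed.

(** The transformation law of the Christoffel symbols. Both sides are paired with
the rows of J by means of the metric, which is nondegenerate. *)
Lemma christoffel_change i j a :
  \sum_l christoffel g c y l i j * J l a =
  H i j a + \sum_b \sum_d J i b * J j d * christoffel g c' (tau y) a b d.
Proof.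
have low b b' d := christoffel_lower g Sc' c'y b b' d.
have low_change := christoffel_lower_change i j.
(* Generalized, because unification would unfold christoffel to a product. *)
move: (christoffel g c' (tau y)) (christoffel g c y) low low_change.
move=> Gam' Gam low low_change.
pose ga := \row_a (\sum_l Gam l i j * J l a).
pose gb := \row_a (H i j a + \sum_b \sum_d J i b * J j d * Gam' a b d).
suff /rowP/(_ a) : ga = gb by rewrite mxE [in RHS]mxE.
have uM : G' *m J^T \in unitmx.
  by rewrite unitmx_mul unitmx_tr jacobian_unit (metric_unitmx g Sc' c'y).
apply: (can_inj (mulmxK uM)); rewrite !mulmxA; apply/rowP => k.
have -> : (ga *m G' *m J^T) 0 k = \sum_l Gam l i j * metric g c y l k.
  rewrite (metric_change g Sc Sc' cc'y) -/tau -/J -/G'.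
  rewrite (_ : ga = (\row_l Gam l i j) *m J); last first.
    by apply/rowP => b; rewrite mxE [RHS]mxE; apply: eq_bigr => l _; rewrite [X in _ = X * _]mxE.
  rewrite -!mulmxA mxE; apply: eq_bigr => l _; by rewrite [X in X * _]mxE mulmxA.
rewrite low_change /A /J3 mxE.
rewrite [RHS](eq_bigr (fun d => \sum_e gb 0 e * G' e d * J k d)); last first.
  by move=> d _; rewrite [(gb *m G') 0 d]mxE mulr_suml; apply: eq_bigr => e _; rewrite [J^T d k]mxE.
rewrite [RHS](eq_bigr (fun d => \sum_e (H i j e * G' e d * J k d +
   \sum_b \sum_b' J i b * J j b' * Gam' e b b' * G' e d * J k d))); last first.
  move=> d _; apply: eq_bigr => e _; rewrite [gb 0 e]mxE mulrDl mulrDl; congr (_ + _).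
  rewrite !mulr_suml; apply: eq_bigr => b _; rewrite !mulr_suml.
  by apply: eq_bigr => b' _.
under [RHS]eq_bigr do rewrite big_split.
rewrite big_split /=; congr (_ + _); first by rewrite exchange_big.
rewrite [RHS](eq_bigr (fun d => \sum_b \sum_b' \sum_e
    J i b * J j b' * J k d * (Gam' e b b' * G' e d))); last first.
  move=> d _; rewrite exchange_big /=; apply: eq_bigr => b _.
  rewrite exchange_big /=; apply: eq_bigr => b' _; apply: eq_bigr => e _; ring.
rewrite [RHS]exchange_big /=; apply: eq_bigr => b _.
rewrite [RHS]exchange_big /=; apply: eq_bigr => b' _; apply: eq_bigr => d _.
by rewrite -mulr_sumr low.
Qed.

(** The second derivatives of tau that appear in the chain rule are those of the
transformation law of the Christoffel symbols, so that the Hessian is a tensor. *)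
Lemma hessian_change f : smooth_function S f ->
  hessian g f c y = J *m hessian g f c' (tau y) *m J^T.
Proof.
move=> sf; pose F := local_expr c' f.
have sF : smooth_on (cod c') F := smooth_local Sc' sf.
have dF := smooth_differentiable sF.
have Fpd j : (forall z, overlap c c' z -> pderiv j (local_expr c f) z =
    \sum_a pderiv j (fun u => tau u 0 a) z * pderiv a F (tau z)).
  move=> z cc'z; rewrite -(pderiv_comp j (f := F)); last 2 first.
  - exact: dtau.
  - exact/dF/transition_cod.
  by apply: near_eq_pderiv; apply: open_near oO cc'z _ => u; exact: local_transition.
have dpF a : differentiable (fun z => pderiv a F (tau z)) y.
  apply: (differentiable_compR (f := pderiv a F)); first exact: dtau.
  exact: smooth_differentiable (smooth_pderiv a sF) c'y.
have dJ a j : differentiable (pderiv j (fun s => tau s 0 a)) y.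
  exact: smooth_differentiable (smooth_pderiv _ (stau a)) cc'y.
have Fpd2 i j : pderiv i (pderiv j (local_expr c f)) y =
    \sum_a (H i j a * pderiv a F (tau y) +
      \sum_b J i b * J j a * pderiv b (pderiv a F) (tau y)).
  rewrite (near_eq_pderiv i (open_near oO cc'y (Fpd j))).
  rewrite (_ : (fun z => _) = \sum_a (pderiv j (fun u => tau u 0 a) \*
      (fun z => pderiv a F (tau z)))); last first.
    by apply/funext => z; rewrite fct_sumE.
  rewrite pderiv_sum => [|a]; last exact: (differentiableM (dJ a j) (dpF a)).
  apply: eq_bigr => a _; rewrite pderivM//.
  rewrite (pderiv_comp i (f := pderiv a F)); last 2 first.
  - exact: dtau.
  - exact: smooth_differentiable (smooth_pderiv a sF) c'y.
  rewrite addrC mulr_sumr; congr (_ + _); apply: eq_bigr => b _.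
  by rewrite -!J_pderiv// -/J; ring.
apply/matrixP => i j; rewrite [LHS]mxE Fpd2.
have -> : \sum_k christoffel g c y k i j * pderiv k (local_expr c f) y =
    \sum_a (H i j a + \sum_b \sum_d J i b * J j d * christoffel g c' (tau y) a b d)
      * pderiv a F (tau y).
  under [RHS]eq_bigr do rewrite -christoffel_change mulr_suml.
  rewrite exchange_big /=; apply: eq_bigr => k _.
  rewrite Fpd// mulr_sumr; apply: eq_bigr => a _.
  by move: (christoffel g c y k i j) => x; rewrite -J_pderiv// mulrA.
have hE b a : hessian g f c' (tau y) b a = pderiv b (pderiv a F) (tau y)
    - \sum_d christoffel g c' (tau y) d b a * pderiv d F (tau y) by rewrite mxE.
move: (hessian g f c' (tau y)) (christoffel g c' (tau y)) hE => B' Gam' hE.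
have -> : (J *m B' *m J^T) i j = \sum_a \sum_b J i b * B' b a * J j a.
  rewrite [LHS]mxE; apply: eq_bigr => a _.
  by rewrite [(J *m B') i a]mxE mulr_suml; apply: eq_bigr => b _; rewrite [J^T a j]mxE.
rewrite [RHS](eq_bigr (fun a => \sum_b J i b * J j a * pderiv b (pderiv a F) (tau y)
    - \sum_b \sum_d J i b * J j a * Gam' d b a * pderiv d F (tau y))); last first.
  move=> a _; rewrite -sumrB; apply: eq_bigr => b _.
  rewrite hE mulrBr mulrBl mulr_sumr mulr_suml; congr (_ - _); first by ring.
  by apply: eq_bigr => d _; ring.
rewrite sumrB big_split -addrA /= [LHS]addrCA; congr (_ + _).
under [X in _ - X]eq_bigr do rewrite mulrDl.
rewrite big_split opprD addrA subrr add0r /=; congr (- _).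
rewrite [RHS](eq_bigr (fun a => \sum_d \sum_b J i b * J j a * Gam' d b a * pderiv d F (tau y))).
  rewrite [RHS]exchange_big /=; apply: eq_bigr => a _.
  rewrite mulr_suml exchange_big /=; apply: eq_bigr => b _.
  by rewrite mulr_suml; apply: eq_bigr => d _.
by move=> a _; rewrite exchange_big.
Qed.

End AtPoint.
End ChartChange.

(** * Strict plurisubharmonicity and orthonormal frames *)

Section OrthPlane.
Context {R : realType} {n : nat} {X : topologicalType}.
Variables (S : smooth_structure R n X) (g : riemannian_metric S).
Variables (p : nat) (phi : diff_form S p).
Hypotheses (p_ge1 : (1 <= p)%N) (phi_calibration : calibration g phi).
Implicit Types (c : chart R n X) (y : 'rV[R]_n) (f : X -> R) (V : 'M[R]_(p, n)).

(** Frames of volume one of a given plane form a noncompact set as soon as p > 1;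
compactness arguments use the orthonormal ones. *)
Definition orth_plane c y V :=
  V *m metric g c y *m V^T = 1%:M /\ form phi c y V = 1.

Definition trace_hessian f c y V := \tr (V *m hessian g f c y *m V^T).

Lemma orth_plane_change c c' y V : atlas S c -> atlas S c' -> overlap c c' y ->
  orth_plane c y V -> orth_plane c' (transition c c' y) (V *m 'J (transition c c') y).
Proof.
move=> Sc Sc' cc'y [V1 wV]; split.
  by rewrite trmx_mul -V1 (metric_change g Sc Sc' cc'y) !mulmxA.
by rewrite -(form_change phi Sc Sc' cc'y).
Qed.

Lemma trace_hessian_change f c c' y V : atlas S c -> atlas S c' ->
  overlap c c' y -> smooth_function S f ->
  trace_hessian f c' (transition c c' y) (V *m 'J (transition c c') y) =
  trace_hessian f c y V.
Proof.
move=> Sc Sc' cc'y sf; rewrite /trace_hessian (hessian_change g Sc Sc' cc'y sf).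
by rewrite trmx_mul !mulmxA.
Qed.

Lemma metric_posdef c y : atlas S c -> cod c y -> posdef (metric g c y).
Proof. by move=> Sc cy; split; [exact: metric_sym|exact: metric_pos]. Qed.

Lemma gram_posdef (G : 'M[R]_n) V : posdef G -> \det (V *m G *m V^T) = 1 ->
  posdef (V *m G *m V^T).
Proof.
move=> [sG pG] dV; split; first by rewrite !trmx_mul trmxK sG mulmxA.
move=> x x0.
have E : x *m (V *m G *m V^T) *m x^T = (x *m V) *m G *m (x *m V)^T.
  by rewrite trmx_mul !mulmxA.
rewrite E; apply: pG; apply: contra x0 => /eqP xV.
have uS : V *m G *m V^T \in unitmx by rewrite unitmxE dV unitr1.
by rewrite -(mulmxK uS x) !mulmxA xV !mul0mx.
Qed.

Lemma gram_simple_norm c y V : simple_norm g c y V = 1 ->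
  \det (V *m metric g c y *m V^T) = 1.
Proof.
rewrite /simple_norm => nV; have : 0 <= \det (V *m metric g c y *m V^T).
  rewrite leNgt; apply/negP => /ltW/ler0_sqrtr; rewrite nV => /eqP.
  by rewrite oner_eq0.
by move=> /sqr_sqrtr <-; rewrite nV expr1n.
Qed.

(** The Cholesky factor of the Gram matrix has determinant one, hence the change of
frame preserves the value of phi. *)
Lemma plane_orthonormalize c y V : atlas S c -> cod c y -> phi_plane g phi c y V ->
  exists L : 'M[R]_p, orth_plane c y (L *m V) /\
    L^T *m L = invmx (V *m metric g c y *m V^T).
Proof.
move=> Sc cy [nV wV]; set Gr := _ *m V^T.
have dG : \det Gr = 1 := gram_simple_norm nV.
have pG : posdef Gr by apply: gram_posdef => //; exact: metric_posdef.
have [L [tL dL LL]] := cholesky pG.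
have dL1 : \det L = 1.
  have /(congr1 determinant) := LL; rewrite !det_mulmx det_tr dG det1 mulr1 -expr2.
  by move=> /eqP; rewrite sqrf_eq1 => /orP[/eqP//|/eqP dN]; move: dL; rewrite dN; lra.
have uL : L \in unitmx by rewrite unitmxE dL1 unitr1.
have uG : Gr \in unitmx by rewrite unitmxE dG unitr1.
exists L; split; first split.
- by rewrite trmx_mul -LL /Gr !mulmxA.
- by rewrite alt_trig ?dL1 ?mul1r//; exact: form_alternating.
- have E : L *m Gr = invmx L^T.
    by rewrite -[RHS]mul1mx -LL mulmxK// unitmx_tr.
  apply: (can_inj (mulmxK uG)); rewrite mulVmx// -mulmxA E mulmxV//.
  by rewrite unitmx_tr.
Qed.

(** The phi-Hessian on a phi-plane is the trace of the Hessian over the plane. This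
is where phi is used as a calibration. *)
Lemma phi_hessian_trace f c y V : atlas S c -> cod c y -> smooth_function S f ->
  phi_plane g phi c y V ->
  phi_hessian g phi f c y V =
  \tr (V *m hessian g f c y *m V^T *m invmx (V *m metric g c y *m V^T)).
Proof.
move=> Sc cy sf [nV wV].
have sl := smooth_local Sc sf.
rewrite /phi_hessian; under eq_bigr do rewrite covariant_derivativeE//.
rewrite (@comass_trace R n p (metric g c y) (form phi c y))//.
- by rewrite nabla_grad_metric.
- exact: metric_sym.
- exact: form_alternating.
- by move=> W; apply: (phi_calibration.2 c Sc y cy).
- exact: gram_simple_norm.
Qed.

(** With P taken to be positivity or nonnegativity, this is strict or weak
plurisubharmonicity of f at x. *)
Definition traces_at (P : R -> Prop) f x := forall c, atlas S c -> dom c x ->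
  forall V, orth_plane c (coord c x) V -> P (trace_hessian f c (coord c x) V).

Lemma traces_at_chart P f c x : atlas S c -> dom c x -> smooth_function S f ->
  (forall V, orth_plane c (coord c x) V ->
    P (trace_hessian f c (coord c x) V)) -> traces_at P f x.
Proof.
move=> Sc cx sf pos c' Sc' c'x V oV; have c'c := overlap_coord c'x cx.
rewrite -(trace_hessian_change _ Sc' Sc c'c)//.
have := orth_plane_change Sc' Sc c'c oV; rewrite transition_coord//.
exact: pos.
Qed.

Lemma strictly_psh_traces f x : smooth_function S f ->
  traces_at (fun t => 0 < t) f x -> strictly_psh_at g phi f x.
Proof.
move=> sf pos c Sc cx V phiV; have cy := coord_cod cx.
rewrite phi_hessian_trace//.
have [L [oL <-]] := plane_orthonormalize Sc cy phiV.
have -> : \tr (V *m hessian g f c (coord c x) *m V^T *m (L^T *m L)) =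
    trace_hessian f c (coord c x) (L *m V).
  by rewrite /trace_hessian mulmxA mxtrace_mulC trmx_mul !mulmxA.
exact: pos.
Qed.

End OrthPlane.

(** * Compactness of the set of calibrated planes *)

Section CompactBounds.
Context {R : realType} {T : topologicalType}.
Implicit Types (A : set T) (f : T -> R).

Lemma compact_lower_bound A f : compact A -> (forall x, A x -> {for x, continuous f}) ->
  (forall x, A x -> 0 < f x) -> exists2 d, 0 < d & forall x, A x -> d <= f x.
Proof.
move=> cA cf pf; have [A0|A0] := pselect (A !=set0); last first.
  by exists 1 => // x Ax; case: A0; exists x.
have [|z] := @compact_EVT_min T R f A A0 cA.
  by apply: continuous_in_subspaceT => x; rewrite inE; exact: cf.
rewrite inE => Az fz; exists (f z); first exact: pf.
by move=> x Ax; apply: fz; rewrite inE.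
Qed.

Lemma compact_abs_bound A f : compact A -> (forall x, A x -> {for x, continuous f}) ->
  exists2 C, 0 <= C & forall x, A x -> `|f x| <= C.
Proof.
move=> cA cf; have [A0|A0] := pselect (A !=set0); last first.
  by exists 0 => // x Ax; case: A0; exists x.
have [|z] := @compact_EVT_max T R (fun x => `|f x|) A A0 cA.
  apply: continuous_in_subspaceT => x; rewrite inE => Ax.
  exact: (cvg_norm (cf x Ax)).
rewrite inE => Az fz; exists `|f z| => //.
by move=> x Ax; apply: fz; rewrite inE.
Qed.

Lemma near_neq (f : T -> R) (x : T) (a : R) : {for x, continuous f} -> f x != a ->
  \forall y \near x, f y != a.
Proof.
move=> cf fxa; apply: (cf [set t | t != a]).
exact: open_nbhs_nbhs (conj (@open_neq R a) fxa).
Qed.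

End CompactBounds.

Section MatrixTopology.
Context {R : realType}.

Lemma entry_continuous m n (M : 'M[R]_(m, n)) i j :
  {for M, continuous (fun N : 'M[R]_(m, n) => N i j)}.
Proof. exact: matrix_normedtype.coord_continuous. Qed.

Lemma vec_mx_continuous m n : continuous (vec_mx : 'rV[R]_(m * n) -> 'M[R]_(m, n)).
Proof.
move=> v; apply: (@differentiable_continuous R 'rV[R]_(m * n) 'M[R]_(m, n)).
rewrite (_ : vec_mx = \sum_i \sum_j (fun v : 'rV[R]_(m * n) =>
  v 0 (mxvec_index i j) *: delta_mx i j)); last first.
  apply/funext => u; rewrite fct_sumE [LHS]matrix_sum_delta.
  apply: eq_bigr => i _; rewrite fct_sumE; apply: eq_bigr => j _.
  by rewrite mxE.
apply: differentiable_sum => i; apply: differentiable_sum => j.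
by apply: differentiableZl; exact: differentiable_coord.
Qed.

Lemma rV_box_compact n (M : R) : compact [set v : 'rV[R]_n | forall i, `|v 0 i| <= M].
Proof.
have := @rV_compact R n (fun=> `[- M, M]%classic) (fun=> @segment_compact R _ _).
by congr compact; apply/seteqP; split=> v /= H i; have := H i; rewrite in_itv /= ler_norml.
Qed.

Lemma mx_box_compact m n (M : R) :
  compact [set V : 'M[R]_(m, n) | forall i j, `|V i j| <= M].
Proof.
have -> : [set V : 'M[R]_(m, n) | forall i j, `|V i j| <= M] =
    vec_mx @` [set v : 'rV[R]_(m * n) | forall i, `|v 0 i| <= M].
  apply/seteqP; split=> [V VM|_ [v vM <-] i j] /=; last by rewrite mxE.
  exists (mxvec V); last by rewrite mxvecK.
  by move=> k /=; case/mxvec_indexP: k => i j; rewrite mxvecE.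
apply: continuous_compact; last exact: rV_box_compact.
by apply: continuous_subspaceT => v; exact: vec_mx_continuous.
Qed.

End MatrixTopology.

Section JointContinuity.
Context {R : realType} {n p : nat} {X : topologicalType}.
Variable (c : chart R n X).

Local Notation T := ('rV[R]_n * 'M[R]_(p, n))%type.

Lemma smooth_continuous (h : 'rV[R]_n -> R) (y : 'rV[R]_n) : smooth_on (cod c) h -> cod c y ->
  {for y, continuous h}.
Proof.
move=> sh cy; apply: differentiable_continuous.
exact: smooth_differentiable sh cy.
Qed.

Lemma cont_fst (h : 'rV[R]_n -> R) (z : T) : smooth_on (cod c) h -> cod c z.1 ->
  h t.1 @[t --> z] --> h z.1.
Proof.
move=> sh cz; apply: (@cvg_comp _ _ _ fst h (nbhs z) (nbhs z.1)).
  exact: cvg_fst.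
exact: smooth_continuous.
Qed.

Lemma cont_snd i j (z : T) : (t : T).2 i j @[t --> z] --> z.2 i j.
Proof.
apply: (@cvg_comp _ _ _ snd (fun V : 'M[R]_(p, n) => V i j) (nbhs z) (nbhs z.2)).
  exact: cvg_snd.
exact: entry_continuous.
Qed.

Lemma near_cod (z : T) : cod c z.1 -> \forall t \near z, cod c t.1.
Proof.
move=> cz; apply: (@cvg_fst _ _ (nbhs z.1) (nbhs z.2) _).
by apply: open_nbhs_nbhs; split => //; exact: cod_open.
Qed.

Lemma quadratic_continuous (B : 'rV[R]_n -> 'M[R]_n) i j (z : T) :
  (forall k l, smooth_on (cod c) (fun y => B y k l)) -> cod c z.1 ->
  ((t : T).2 *m B t.1 *m t.2^T) i j @[t --> z] --> (z.2 *m B z.1 *m z.2^T) i j.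
Proof.
move=> sB cz.
have E (t : T) : (t.2 *m B t.1 *m t.2^T) i j =
    \sum_l (\sum_k t.2 i k * B t.1 k l) * t.2 j l.
  by rewrite mxE; apply: eq_bigr => l _; rewrite [t.2^T l j]mxE mxE.
rewrite E; under eq_fun do rewrite E.
apply: cvg_sumr => l; apply: cvgM; last exact: cont_snd.
apply: cvg_sumr => k; apply: cvgM; first exact: cont_snd.
exact: (cont_fst (h := fun y => B y k l)).
Qed.

End JointContinuity.

(** The minimum of the metric over the unit sphere bundle above K. *)
Lemma metric_lower_bound {R : realType} {n : nat} {X : topologicalType}
    (S : smooth_structure R n X) (g : riemannian_metric S) c (K : set 'rV[R]_n) :
  atlas S c -> compact K -> K `<=` cod c ->
  exists2 d, 0 < d & forall y (v : 'rV[R]_n), K y ->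
    d * `|v| ^+ 2 <= (v *m metric g c y *m v^T) 0 0.
Proof.
move=> Sc cK Kc; pose Sph := [set v : 'rV[R]_n | `|v| = 1].
have cS : compact Sph.
  apply: bounded_closed_compact.
    by exists 1; split=> // M M1 v /= ->; exact: ltW.
  apply: (@preimage_closed _ _ (fun v : 'rV[R]_n => `|v|) [set 1]).
    by move=> v _; exact: norm_continuous.
  exact: closed_eq.
have [| | |d d0 dP] := @compact_lower_bound R _ (K `*` Sph)
    (fun t : 'rV[R]_n * 'rV[R]_n => (t.2 *m metric g c t.1 *m t.2^T) 0 0).
- exact: compact_setX.
- move=> [y v] [/= Ky _]; apply: (@quadratic_continuous R n 1 X c (metric g c)).
    by move=> k l; exact: metric_smooth.
  exact: Kc.
- move=> [y v] [/= Ky v1]; apply: (metric_pos g Sc (Kc _ Ky)).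
  by apply/eqP => v0; move: v1; rewrite /Sph /= v0 normr0 => /eqP; rewrite eq_sym oner_eq0.
exists d => // y v Ky; have [->|v0] := eqVneq v 0.
  by rewrite normr0 expr0n mulr0 !mul0mx mxE.
have nv : 0 < `|v| by rewrite normr_gt0.
have := dP (y, `|v|^-1 *: v) _; rewrite /= => H.
have {H} : d <= `|v|^-1 * (`|v|^-1 * (v *m metric g c y *m v^T) 0 0).
  have := H (conj Ky _); rewrite linearZ /= -!scalemxAl -scalemxAr !mxE; apply.
  by rewrite /Sph /= normrZ normfV normr_id mulVf// gt_eqF.
by rewrite mulrA -invfM -expr2 mulrC ler_pdivlMr// exprn_gt0.
Qed.

Section PlaneCompactness.
Context {R : realType} {n : nat} {X : topologicalType}.
Variables (S : smooth_structure R n X) (g : riemannian_metric S).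
Variables (p : nat) (phi : diff_form S p).
Variables (c : chart R n X) (Sc : atlas S c).
Implicit Types (y : 'rV[R]_n) (V : 'M[R]_(p, n)) (f : X -> R).

Local Notation T := ('rV[R]_n * 'M[R]_(p, n))%type.

Let mix k V V0 : 'M[R]_(p, n) :=
  \matrix_(i < p) if (i < k)%N then row i V else row i V0.

(** Separate continuity in y gives joint continuity because the rows of V enter
linearly: each one is expanded on the canonical basis in turn. *)
Lemma form_continuous (z : T) : cod c z.1 ->
  form phi c t.1 t.2 @[t --> z] --> form phi c z.1 z.2.
Proof.
move=> cz.
suff main k V0 : (k <= p)%N ->
    form phi c t.1 (mix k t.2 V0) @[t --> z] --> form phi c z.1 (mix k z.2 V0).
  have mixp V V0 : mix p V V0 = V by apply/row_matrixP => i; rewrite rowK ltn_ord.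
  have := main p 0 (leqnn p); rewrite mixp.
  by under eq_fun do rewrite mixp.
elim: k V0 => [|k IH] V0 kp.
  have mix0 V : mix 0 V V0 = V0 by apply/row_matrixP => i; rewrite rowK.
  rewrite mix0; under eq_fun do rewrite mix0.
  by apply: (cont_fst (c := c) (h := fun y => form phi c y V0)) => //; exact: form_smooth.
have E t : cod c t.1 -> form phi c t.1 (mix k.+1 t.2 V0) =
    \sum_j t.2 (Ordinal kp) j *
      form phi c t.1 (mix k t.2 (replace_row (Ordinal kp) (delta_mx 0 j) V0)).
  move=> ct; rewrite (_ : mix k.+1 t.2 V0 = replace_row (Ordinal kp)
      (\sum_j t.2 (Ordinal kp) j *: delta_mx 0 j) (mix k t.2 V0)); last first.
    apply/row_matrixP => i; rewrite !rowK ltnS; case: eqP => [->|/eqP ik].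
      by rewrite /= leqnn [LHS]row_sum_delta; apply: eq_bigr => j _; rewrite mxE.
    by rewrite leq_eqVlt -[(i == k :> nat)]/(i == Ordinal kp) (negbTE ik).
  rewrite alt_replace_sum; last exact: form_alternating.
  apply: eq_bigr => j _; congr (_ * form phi c _ _); apply/row_matrixP => i.
  rewrite !rowK; case: eqP => [->|/eqP ik]; first by rewrite ltnn.
  by case: ifP.
rewrite E//.
have lim_sum : \sum_j (t : T).2 (Ordinal kp) j * form phi c t.1
      (mix k t.2 (replace_row (Ordinal kp) (delta_mx 0 j) V0)) @[t --> z] -->
    \sum_j z.2 (Ordinal kp) j * form phi c z.1
      (mix k z.2 (replace_row (Ordinal kp) (delta_mx 0 j) V0)).
  apply: cvg_sumr => j; apply: cvgM; first exact: cont_snd.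
  by apply: IH; exact: ltnW.
apply: cvg_trans lim_sum; apply: near_eq_cvg; near=> t; rewrite E//.
by near: t; exact: near_cod.
Unshelve. all: by end_near. Qed.

Lemma trace_hessian_continuous f (z : T) : smooth_function S f -> cod c z.1 ->
  {for z, continuous (fun t : T => trace_hessian g f c t.1 t.2)}.
Proof.
move=> sf cz; apply: cvg_sumr => i.
apply: (quadratic_continuous (c := c)) => // k l.
exact: (smooth_hessian g k l Sc (smooth_local Sc sf)).
Qed.

Definition planes_over (K : set 'rV[R]_n) : set T :=
  [set z | K z.1 /\ orth_plane g phi c z.1 z.2].

Let near_not_orth (z : T) : cod c z.1 -> ~ orth_plane g phi c z.1 z.2 ->
  \forall t \near z, ~ orth_plane g phi c t.1 t.2.
Proof.
move=> cz /not_andP[gz|wz].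
  have [i [j gij]] : exists i, exists j,
      (z.2 *m metric g c z.1 *m z.2^T) i j != 1%:M i j.
    apply: contrapT => H; apply: gz; apply/matrixP => i j.
    by apply: contrapT => /eqP gij; apply: H; exists i, j.
  have cq : {for z, continuous (fun t : T => (t.2 *m metric g c t.1 *m t.2^T) i j)}.
    by apply: (quadratic_continuous (c := c)) => // k l; exact: metric_smooth.
  by apply: filterS (near_neq cq gij) => t /eqP tij [gt _]; apply: tij; rewrite gt.
have /eqP wz' := wz.
by apply: filterS (near_neq (form_continuous cz) wz') => t /eqP tw [_ /tw].
Qed.

(** Orthonormality bounds V because the metric dominates a multiple of the
standard one on K. *)
Lemma planes_over_compact (K : set 'rV[R]_n) : compact K -> K `<=` cod c ->
  compact (planes_over K).
Proof.
move=> cK Kc; have [d d0 dG] := metric_lower_bound g Sc cK Kc.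
have cB := @mx_box_compact R p n (Num.sqrt d^-1).
apply: (@subclosed_compact _ _
  (K `*` [set V : 'M[R]_(p, n) | forall i j, `|V i j| <= Num.sqrt d^-1])).
- have clK : closed K by apply: compact_closed => //; exact: norm_hausdorff.
  rewrite -[X in closed X]setCK; apply: open_closedC; rewrite openE => z nz.
  have [Kz|nKz] := pselect (K z.1); last first.
    have : \forall t \near z, ~ K t.1.
      apply: (@cvg_fst _ _ (nbhs z.1) (nbhs z.2) _ (~` K)).
      by apply: open_nbhs_nbhs; split => //; exact: closed_openC.
    by apply: filterS => t nKt [].
  have nz' : ~ orth_plane g phi c z.1 z.2 by move=> oz; apply: nz.
  by apply: filterS (near_not_orth (Kc _ Kz) nz') => t nt [].
- exact: compact_setX.
- move=> [y V] [/= Ky [gV _]]; split => //= i j.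
  have := dG y (row i V) Ky.
  have -> : row i V *m metric g c y *m (row i V)^T = 1%:M.
    apply/matrixP => a b; rewrite !ord1 -[in RHS](_ : (1%:M : 'M[R]_p) i i = 1).
      rewrite -gV -!row_mul !mxE; apply: eq_bigr => k _.
      by rewrite !mxE.
    by rewrite mxE eqxx.
  rewrite mxE eqxx -ler_pdivlMl// mulr1 => nV.
  rewrite -[`|V i j|]ger0_norm// -sqrtr_sqr ler_wsqrtr//; apply: le_trans nV.
  have := norm_entry (row i V) j; rewrite mxE => Vij.
  by rewrite !expr2 ler_pM.
Qed.

End PlaneCompactness.

Section Lindelof.
Context {T : topologicalType} {Y : Type}.

(** A statement that holds locally for witnesses in P holds everywhere for the
witnesses of some sequence: one witness is chosen for each basic open set on which
some witness works. *)
Lemma lindelof (P : Y -> Prop) (y0 : Y) (D : set T) (Q : Y -> T -> Prop) :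
  @second_countable T -> P y0 ->
  (forall x, D x -> exists2 y, P y & \forall x' \near x, D x' -> Q y x') ->
  exists e : nat -> Y, (forall k, P (e k)) /\ forall x, D x -> exists k, Q (e k) x.
Proof.
move=> [B /countable_injP[i inj_i] [_ nB]] Py0 loc.
pose L k y := P y /\ exists b, [/\ B b, i b = k & forall x, b x -> D x -> Q y x].
have /choice[e eP] : forall k, exists y, P y /\ ((exists y', L k y') -> L k y).
  move=> k; have [[y Ly]|nL] := pselect (exists y', L k y').
    by exists y; split=> //; case: Ly.
  by exists y0; split.
exists e; split=> [k|x Dx]; first by have [] := eP k.
have [y Py /nB[b [Bb bx] /= bQ]] := loc x Dx.
have [_ /(_ _)[]] := eP (i b).
  by exists y; split => //; exists b; split => // x' /bQ.
move=> _ [b' [Bb' /inj_i]]; rewrite !inE => /(_ Bb' Bb) -> eQ.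
by exists (i b); apply: eQ.
Qed.

End Lindelof.

Section Openness.
Context {R : realType} {n : nat} {X : topologicalType}.
Variables (S : smooth_structure R n X) (g : riemannian_metric S).
Variables (p : nat) (phi : diff_form S p).
Implicit Types (c : chart R n X) (y : 'rV[R]_n) (f : X -> R) (V : 'M[R]_(p, n)).

Lemma closed_ball_cod c y : cod c y -> exists2 r, 0 < r & closed_ball y r `<=` cod c.
Proof.
move=> cy; have : nbhs y (cod c) by apply: open_nbhs_nbhs; split=> //; exact: cod_open.
move=> /nbhs_ballP[r /= r0 rc]; exists (r / 2); first by rewrite divr_gt0.
apply: subset_trans rc; apply: closed_ball_subset; first by rewrite divr_gt0.
by rewrite ltr_pdivrMr// ltr_pMr// ltr1n.
Qed.

Lemma closed_ball_compact y (r : R) : 0 < r -> compact (closed_ball y r).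
Proof.
move=> r0; apply: bounded_closed_compact; last exact: closed_ball_closed.
exists (`|y| + r); split; first exact: num_real.
move=> M yrM z; rewrite closed_ballE// /closed_ball_ /= => yz.
apply: le_trans (ltW yrM); rewrite -[z](subrK y) addrC.
by apply: le_trans (ler_normD _ _) _; rewrite lerD2l distrC.
Qed.

(** The frames over a compact neighbourhood where the trace fails to be positive
form a compact set, whose projection misses the point. *)
Lemma traces_gt0_open f x : smooth_function S f ->
  traces_at g phi (fun t => 0 < t) f x -> \forall x' \near x, traces_at g phi (fun t => 0 < t) f x'.
Proof.
move=> sf fx; have [c Sc cx] := atlas_cover S x.
have cy := coord_cod cx; set y := coord c x in cy.
have [r r0 Kc] := closed_ball_cod cy; set K := closed_ball y r in Kc.
have cK : compact K by exact: closed_ball_compact.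
have cP : compact (planes_over g phi c K) by exact: planes_over_compact.
pose Z : set ('rV[R]_n * 'M[R]_(p, n)) :=
  planes_over g phi c K `&` [set z | trace_hessian g f c z.1 z.2 <= 0].
have cZ : compact Z.
  apply: (subclosed_compact _ cP); last by move=> z [].
  have clP : closed (planes_over g phi c K).
    by apply: compact_closed => //; exact: norm_hausdorff.
  rewrite -[X in closed X]setCK; apply: open_closedC; rewrite openE => z nz.
  have [Pz|nPz] := pselect (planes_over g phi c K z); last first.
    have : \forall t \near z, ~ planes_over g phi c K t.
      by apply: open_nbhs_nbhs; split=> //; exact: closed_openC.
    by apply: filterS => t nPt [].
  have tz : 0 < trace_hessian g f c z.1 z.2.
    by rewrite ltNge; apply/negP => tz; apply: nz.
  have : \forall t \near z, 0 < trace_hessian g f c t.1 t.2.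
    apply: (trace_hessian_continuous Sc (z := z) sf (Kc _ Pz.1) (t := [set s | 0 < s])).
    exact: lt_nbhsr.
  by apply: filterS => t tt [_ /=]; rewrite leNgt tt.
have clZ : closed (fst @` Z).
  apply: compact_closed; first exact: norm_hausdorff.
  by apply: continuous_compact => //; apply: continuous_subspaceT => z; exact: cvg_fst.
have nyZ : ~ (fst @` Z) y.
  move=> [[y' V] [[/= _ oV] /= tr0] yy]; rewrite {}yy in oV tr0.
  by have := fx c Sc cx V oV; rewrite ltNge tr0.
have ny : nbhs (coord c x) (~` (fst @` Z)).
  by apply: open_nbhs_nbhs; split=> //; exact: closed_openC.
have Ky : nbhs (coord c x) K.
  by apply: filterS (nbhsx_ballx y _ r0); exact: subset_closed_ball.
have cxc : coord c @ x --> coord c x := coord_continuous cx.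
have nyx : nbhs x (coord c @^-1` (K `&` ~` (fst @` Z))).
  by apply: cxc; exact: filterI.
apply: filterS (filterI nyx (dom_nbhs cx)) => x' [[Kx' nZx'] c'x].
apply: (traces_at_chart Sc c'x sf) => V oV; rewrite ltNge; apply/negP => tr0.
by apply: nZx'; exists (coord c x', V).
Qed.

End Openness.

(** * Constructing smooth functions on the manifold *)

Section SmoothFunctions.
Context {R : realType} {n : nat} {X : topologicalType}.
Variables (S : smooth_structure R n X) (g : riemannian_metric S).
Implicit Types (c : chart R n X) (y : 'rV[R]_n) (f : X -> R).

Lemma smooth_function_local f :
  (forall x, exists c B, [/\ atlas S c, dom c x, open B, B (coord c x) &
     smooth_on B (local_expr c f)]) -> smooth_function S f.
Proof.
move=> loc c' Sc'; apply: smooth_near => y c'y.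
have [c [B [Sc cx oB By sB]]] := loc (param c' y).
have c'cy : overlap c' c y by [].
pose tau := transition c' c; have stau := smooth_transition Sc' Sc.
pose U := overlap c' c `&` tau @^-1` B.
have oU : open U.
  rewrite openE => z [c'cz Bz]; apply: filterI.
    by apply: open_nbhs_nbhs; split=> //; exact: open_overlap.
  have ctau : tau @ z --> tau z.
    by apply: differentiable_continuous; exact: smooth_map_differentiable stau c'cz.
  by apply: ctau; exact: open_nbhs_nbhs.
exists U; first by split.
apply: (smooth_ext oU (f := fun z => local_expr c f (tau z))).
  by move=> z [c'cz _]; exact/esym/(local_transition f c'cz).
apply: smooth_comp sB => //; last by move=> z [].
by move=> j; apply: sub_smooth (stau j) => z [].
Qed.

Lemma smooth_function_continuous f : smooth_function S f -> continuous f.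
Proof.
move=> sf x; have [c Sc cx] := atlas_cover S x.
have cf : local_expr c f @ coord c x --> local_expr c f (coord c x).
  apply: differentiable_continuous.
  exact: smooth_differentiable (smooth_local Sc sf) (coord_cod cx).
have cc : coord c @ x --> coord c x := coord_continuous cx.
have fx : local_expr c f (coord c x) = f x by rewrite /local_expr coordK.
rewrite fx in cf; have H := cvg_comp _ _ cc cf.
apply: cvg_trans H; apply: near_eq_cvg.
by apply: filterS (dom_nbhs cx) => z cz /=; rewrite /local_expr /= coordK.
Qed.

Lemma smooth_function_cst (a : R) : smooth_function S (cst a).
Proof. by move=> c Sc; apply: smooth_cst; exact: cod_open. Qed.

Lemma smooth_function_lin f h (a : R) : smooth_function S f ->
  smooth_function S h -> smooth_function S (fun x => f x + a * h x).
Proof.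
move=> sf sh c Sc; have oc := open_cod c.
apply: (smoothD oc (sf c Sc)); apply: (smoothM oc (smooth_cst a oc)); exact: sh.
Qed.

Lemma pderiv_lin (u w : 'rV[R]_n -> R) (a : R) i y : differentiable u y ->
  differentiable w y ->
  pderiv i (fun z => u z + a * w z) y = pderiv i u y + a * pderiv i w y.
Proof.
move=> du dw.
have da : differentiable (cst a : 'rV[R]_n -> R) y by exact: differentiable_cst.
rewrite -[LHS]/(pderiv i (u \+ (cst a \* w)) y) pderivD//; last exact: differentiableM.
by rewrite pderivM// pderiv_cst mul0r addr0.
Qed.

Lemma hessian_lin f h (a : R) c y : smooth_function S f -> smooth_function S h ->
  atlas S c -> cod c y ->
  hessian g (fun x => f x + a * h x) c y = hessian g f c y + a *: hessian g h c y.
Proof.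
move=> sf sh Sc cy.
have d1 z : cod c z -> differentiable (local_expr c f) z.
  exact: smooth_differentiable (smooth_local Sc sf).
have d2 z : cod c z -> differentiable (local_expr c h) z.
  exact: smooth_differentiable (smooth_local Sc sh).
have E j z : cod c z -> pderiv j (local_expr c (fun x => f x + a * h x)) z =
    pderiv j (local_expr c f) z + a * pderiv j (local_expr c h) z.
  by move=> cz; rewrite -pderiv_lin; [|exact: d1|exact: d2].
apply/matrixP => i j; rewrite !mxE.
rewrite (near_eq_pderiv i (open_near (open_cod c) cy (E j))) pderiv_lin; last 2 first.
- exact: smooth_differentiable (smooth_pderiv j (smooth_local Sc sf)) cy.
- exact: smooth_differentiable (smooth_pderiv j (smooth_local Sc sh)) cy.
under eq_bigr do rewrite E// mulrDr.
rewrite big_split opprD /= mulrBr !addrA; congr (_ - _); last first.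
  rewrite mulr_sumr; apply: eq_bigr => k _.
  by move: (christoffel g c y k i j) => x; ring.
by rewrite addrAC.
Qed.

Lemma trace_hessian_lin p f h (a : R) c y (V : 'M[R]_(p, n)) :
  smooth_function S f -> smooth_function S h -> atlas S c -> cod c y ->
  trace_hessian g (fun x => f x + a * h x) c y V =
  trace_hessian g f c y V + a * trace_hessian g h c y V.
Proof.
move=> sf sh Sc cy; rewrite /trace_hessian hessian_lin// mulmxDr mulmxDl.
by rewrite -scalemxAr -scalemxAl linearD linearZ.
Qed.

(** ** Extension by zero *)

Definition extend_by_zero c (h : 'rV[R]_n -> R) : X -> R :=
  fun x => if `[< dom c x >] then h (coord c x) else 0.

Lemma extend_by_zeroE c h x : dom c x -> extend_by_zero c h x = h (coord c x).
Proof. by move=> cx; rewrite /extend_by_zero asboolT. Qed.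

Lemma local_extend_by_zero c h y : cod c y -> local_expr c (extend_by_zero c h) y = h y.
Proof.
by move=> cy; rewrite /local_expr extend_by_zeroE ?paramK//; exact: param_dom.
Qed.

Lemma param_compact_closed c (K : set 'rV[R]_n) : compact K -> K `<=` cod c ->
  closed (param c @` K).
Proof.
move=> cK Kc; apply: compact_closed; first exact: manifold_hausdorff S.
apply: continuous_compact => //; apply: continuous_in_subspaceT => y; rewrite inE.
by move=> /Kc; exact: param_continuous.
Qed.

(** The image of K is closed because the manifold is Hausdorff, so that the
extension vanishes near every point outside the chart. *)
Lemma extend_by_zero_smooth c h (K : set 'rV[R]_n) : atlas S c ->
  smooth_on (cod c) h -> compact K -> K `<=` cod c ->
  (forall y, cod c y -> ~ K y -> h y = 0) ->
  smooth_function S (extend_by_zero c h).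
Proof.
move=> Sc sh cK Kc h0; apply: smooth_function_local => x.
have [cx|ncx] := pselect (dom c x).
  exists c, (cod c); split=> //; [exact: cod_open|exact: coord_cod|].
  apply: (smooth_ext (open_cod c) _ sh) => y cy.
  by rewrite local_extend_by_zero.
have [c' Sc' c'x] := atlas_cover S x.
have clK := param_compact_closed cK Kc.
pose B := cod c' `&` param c' @^-1` (~` (param c @` K)).
have oB : open B.
  rewrite openE => z [c'z nKz]; apply: filterI.
    by apply: open_nbhs_nbhs; split=> //; exact: cod_open.
  have cp : param c' @ z --> param c' z := param_continuous c'z.
  by apply: cp; apply: open_nbhs_nbhs; split=> //; exact: closed_openC.
exists c', B; split=> //.
  split; first exact: coord_cod.
  by rewrite /= coordK// => -[y /Kc/param_dom cy yx]; apply: ncx; rewrite -yx.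
apply: (smooth_ext oB _ (smooth_cst 0 oB)) => z [c'z nKz] /=.
rewrite /local_expr /extend_by_zero; case: asboolP => // cz; rewrite h0//.
  exact: coord_cod.
by move=> Kz; apply: nKz; exists (coord c (param c' z)) => //; exact: coordK.
Qed.

End SmoothFunctions.

Section WeightedSum.
Context {R : realType} {n : nat} {X : topologicalType}.
Variables (S : smooth_structure R n X) (g : riemannian_metric S).
Implicit Types (c : chart R n X) (y : 'rV[R]_n) (f : X -> R).

Lemma iter_pderiv_scale U (u : 'rV[R]_n -> R) (a : R) s y : open U ->
  smooth_on U u -> U y ->
  iter_pderiv s (fun z => a * u z) y = a * iter_pderiv s u y.
Proof.
move=> oU su; elim: s y => //= i s IH y Uy.
rewrite (near_eq_pderiv i (open_near oU Uy IH)).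
have da : differentiable (cst a : 'rV[R]_n -> R) y by exact: differentiable_cst.
have ds := smooth_differentiable (smooth_iter_pderiv s su) Uy.
by rewrite (pderivM i da ds) pderiv_cst mul0r addr0.
Qed.

Lemma ball_convex y (r : R) : convex_set (ball y r).
Proof.
move=> u v s /andP[s0 s1]; rewrite -ball_normE /= => yu yv.
have -> : y - (u + s *: (v - u)) = (1 - s) *: (y - u) + s *: (y - v).
  rewrite !scalerBr !scalerBl !scale1r; apply/rowP => j; rewrite !mxE; ring.
apply: le_lt_trans (ler_normD _ _) _; rewrite !normrZ (ger0_norm s0) ger0_norm ?subr_ge0//.
have [s10|sn0] := eqVneq s 0; first by rewrite s10 subr0 mul1r mul0r addr0.
have sp : 0 < s by rewrite lt_neqAle eq_sym sn0.
have : s * `|y - v| < s * r by rewrite ltr_pM2l.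
have : (1 - s) * `|y - u| <= (1 - s) * r by rewrite ler_wpM2l ?subr_ge0// ltW.
lra.
Qed.

(** A countable family of smooth functions becomes summable with all its
derivatives after multiplication by small weights: the k-th weight controls the
derivatives with code at most k over the first k members of a countable family
of compact balls whose interiors cover the manifold. *)
Lemma weighted_sum (f : nat -> X -> R) : (forall k, smooth_function S (f k)) ->
  exists e : nat -> R, (forall k, 0 < e k) /\
  let F x := limn (series (fun k => e k * f k x)) in
  [/\ smooth_function S F, forall x, cvgn (series (fun k => e k * f k x)) &
    forall x, exists c, [/\ atlas S c, dom c x & forall i j,
      series (fun k => e k * hessian g (f k) c (coord c x) i j) @ \oo -->
        hessian g F c (coord c x) i j]].
Proof.
move=> sf.
have [[x0]|noX] := pselect (inhabited X); last first.
  have nX (x : X) : False by apply: noX.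
  by exists (fun=> 1); split=> // F; split=> [c Sc s y cy|x|x];
    [case: (nX (param c y))|case: (nX x)|case: (nX x)].
(* ch z is a chart at z with the radius of a ball around z in it; c, ctr and r below
describe a countable family of such balls that still covers X. *)
have /choice[ch chP] (x : X) : exists cr : chart R n X * R, [/\ atlas S cr.1,
    dom cr.1 x, 0 < cr.2 & closed_ball (coord cr.1 x) cr.2 `<=` cod cr.1].
  have [c Sc cx] := atlas_cover S x.
  by have [r r0 Kr] := closed_ball_cod (coord_cod cx); exists (c, r).
pose Q z x := dom (ch z).1 x /\
  ball (coord (ch z).1 z) (ch z).2 (coord (ch z).1 x).
have [||x _|e0 [_ e0P]] := @lindelof X X (fun=> True) x0 setT Q.
- exact: manifold_second_countable S.
- by [].
- exists x => //; have [_ cx r0 _] := chP x.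
  have cc : coord (ch x).1 @ x --> coord (ch x).1 x := coord_continuous cx.
  have nb : nbhs x (coord (ch x).1 @^-1` ball (coord (ch x).1 x) (ch x).2).
    by apply: cc; exact: nbhsx_ballx.
  by apply: filterS (filterI nb (dom_nbhs cx)) => z [bz cz] _.
pose c j := (ch (e0 j)).1; pose r j := (ch (e0 j)).2.
pose ctr j := coord (c j) (e0 j).
have Sc j : atlas S (c j) by have [] := chP (e0 j).
have r0 j : 0 < r j by have [] := chP (e0 j).
have Kc j : closed_ball (ctr j) (r j) `<=` cod (c j) by have [] := chP (e0 j).
have Bc j : ball (ctr j) (r j) `<=` cod (c j).
  by apply: subset_trans (Kc j); exact: subset_closed_ball.
(* b (k, j, t) bounds the derivative of f k with code t over the j-th ball. *)
have /choice[b bP] (kjt : nat * nat * nat) : exists b : R, 0 <= b /\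
    forall s : seq 'I_n, unpickle kjt.2 = Some s ->
    forall y, closed_ball (ctr kjt.1.2) (r kjt.1.2) y ->
    `|iter_pderiv s (local_expr (c kjt.1.2) (f kjt.1.1)) y| <= b.
  case: kjt => [[k j] t] /=; case: (unpickle t) => [s|]; last by exists 0.
  have sfk := smooth_iter_pderiv s (smooth_local (Sc j) (sf k)).
  have [|C C0 CP] := compact_abs_bound (closed_ball_compact (y := ctr j) (r0 j))
      (f := iter_pderiv s (local_expr (c j) (f k))).
    by move=> y /Kc cy; exact: (smooth_continuous (c := c j) sfk cy).
  by exists C; split=> // _ [<-].
pose C k := \sum_(j < k.+1) \sum_(t < k.+1) b (k, nat_of_ord j, nat_of_ord t).
have b0 i : 0 <= b i by have [] := bP i.
have C0 k : 0 <= C k by apply: sumr_ge0 => j _; apply: sumr_ge0.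
have bC k j t : (j <= k)%N -> (t <= k)%N -> b (k, j, t) <= C k.
  move=> jk tk; rewrite /C (bigD1 (Ordinal (jk : (j < k.+1)%N)))//=.
  rewrite (bigD1 (Ordinal (tk : (t < k.+1)%N)))//= -addrA lerDl.
  by rewrite addr_ge0//; do ?[apply: sumr_ge0 => *].
pose e k := 2^-1 ^+ k / (1 + C k) : R.
have C1 k : 0 < 1 + C k by rewrite ltr_pwDl.
have e_gt0 k : 0 < e k by rewrite divr_gt0// exprn_gt0// invr_gt0.
exists e; split=> // F.
pose G j k := local_expr (c j) (fun x => e k * f k x).
have oB j : open (ball (ctr j) (r j)) by exact: ball_open.
have sG j k : smooth_on (cod (c j)) (local_expr (c j) (f k)) := smooth_local (Sc j) (sf k).
have rG j : rapid_on (ball (ctr j) (r j)) (G j).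
  split=> [k|s].
    apply: (sub_smooth (Bc j)); apply: (smoothM (open_cod (c j)) _ (sG j k)).
    exact: smooth_cst (open_cod (c j)).
  exists (maxn j (pickle s)) => k; rewrite geq_max => /andP[jk sk] y By.
  rewrite /G /local_expr (iter_pderiv_scale (U := cod (c j)))//; last 3 first.
  - exact: open_cod.
  - exact: sG.
  - exact: Bc.
  have [_ /(_ s)] := bP (k, j, pickle s); rewrite /= pickleK => /(_ erefl y) bs.
  rewrite normrM (gtr0_norm (e_gt0 k)) /e mulrAC ler_pdivrMr// ler_wpM2l//.
  apply: le_trans (bs _) _; first exact: subset_closed_ball.
  by apply: le_trans (bC k j _ jk sk) _; rewrite lerDr.
have FE j : local_expr (c j) F = fseries (G j) by [].
have cB j : convex_set (ball (ctr j) (r j)) := @ball_convex (ctr j) (r j).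
split.
- apply: smooth_function_local => x; have [j [cx Bx]] := e0P x I.
  by exists (c j), (ball (ctr j) (r j)); split=> //; rewrite FE; exact: fseries_smooth.
- move=> x; have [j [cx Bx]] := e0P x I.
  have := rapid_cvg (rapid_on_rapid (rG j) Bx).
  by rewrite /G /local_expr /= coordK.
- move=> x; have [j [cx Bx]] := e0P x I; exists (c j); split=> //.
  move=> a b'; set y := coord (c j) x.
  have cy : cod (c j) y by exact: coord_cod.
  have cvgs s : series (fun k => iter_pderiv s (G j k) y) @ \oo -->
      iter_pderiv s (local_expr (c j) F) y.
    rewrite FE (fseries_iter_pderiv s (oB j) (cB j) (rG j) Bx).
    exact: rapid_cvg (rapid_on_rapid (rapid_on_iter_pderiv s (rG j)) Bx).
  have E k : e k * hessian g (f k) (c j) y a b' = iter_pderiv [:: a; b'] (G j k) y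
      - \sum_l christoffel g (c j) y l a b' * iter_pderiv [:: l] (G j k) y.
    rewrite (iter_pderiv_scale (e k) [:: a; b'] (open_cod (c j)) (sG j k) cy).
    under eq_bigr do
      rewrite (iter_pderiv_scale (e k) [:: _] (open_cod (c j)) (sG j k) cy).
    rewrite mxE mulrBr; congr (_ - _); rewrite mulr_sumr; apply: eq_bigr => l _.
    by rewrite mulrCA.
  have -> : series (fun k => e k * hessian g (f k) (c j) y a b') =
      (fun m => series (fun k => iter_pderiv [:: a; b'] (G j k) y) m -
        \sum_l christoffel g (c j) y l a b' *
          series (fun k => iter_pderiv [:: l] (G j k) y) m).
    apply/funext => m; rewrite /series /=; under eq_bigr do rewrite E.
    rewrite sumrB exchange_big /=; congr (_ - _); apply: eq_bigr => l _.
    by rewrite mulr_sumr.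
  have -> : hessian g F (c j) y a b' = iter_pderiv [:: a; b'] (local_expr (c j) F) y -
      \sum_l christoffel g (c j) y l a b' * iter_pderiv [:: l] (local_expr (c j) F) y.
    by rewrite mxE.
  apply: cvgB; first exact: cvgs.
  apply: cvg_sumr => l; apply: cvgMl_tmp; exact: cvgs.
Qed.

End WeightedSum.

(** * Bumps and squared distances to a slice *)

Section Bump.
Context {R : realType} {n : nat}.
Implicit Types (y a : 'rV[R]_n) (U : set 'rV[R]_n).

(** The squared Euclidean distance is used here because the norm of row vectors, the maximum
of the coordinates, is not smooth. *)
Definition sqdist a y : R := \sum_j (y 0 j - a 0 j) ^+ 2.

Lemma smooth_sqdist U a : open U -> smooth_on U (sqdist a).
Proof.
move=> oU; apply: smooth_sum => // j.
have sj : smooth_on U (fun y => y 0 j - a 0 j).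
  exact: (smoothD oU (smooth_coord j oU) (smooth_cst (- a 0 j) oU)).
apply: (smooth_ext oU _ (smoothM oU sj sj)) => y _ /=.
by rewrite expr2.
Qed.

Definition bump a (r : R) y : R := flat 0 (r ^+ 2 - sqdist a y).

Lemma smooth_bump U a r : open U -> smooth_on U (bump a r).
Proof.
move=> oU; apply: (smooth_flat oU (f := fun y => r ^+ 2 - sqdist a y)).
apply: (smooth_ext oU _ (smoothD oU (smooth_cst (r ^+ 2) oU)
  (smoothM oU (smooth_cst (-1) oU) (smooth_sqdist a oU)))) => y _ /=.
by rewrite mulN1r.
Qed.

Lemma bump_ge0 a r y : 0 <= bump a r y.
Proof. exact: flat_ge0. Qed.

Lemma bump_gt0 a r y : sqdist a y < r ^+ 2 -> 0 < bump a r y.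
Proof. by move=> yr; apply: flat_gt0; rewrite subr_gt0. Qed.

Lemma bump_center a r : 0 < r -> 0 < bump a r a.
Proof.
move=> r0; apply: bump_gt0; rewrite /sqdist big1 ?exprn_gt0// => j _.
by rewrite subrr expr0n.
Qed.

Definition bump_supp a (r : R) := [set y | sqdist a y <= r ^+ 2].

Lemma bump_eq0 a r y : ~ bump_supp a r y -> bump a r y = 0.
Proof. by move=> /negP; rewrite -ltNge => ry; apply: flat_eq0; rewrite subr_le0 ltW. Qed.

Lemma bump_supp_ball a (r : R) : 0 < r -> bump_supp a r `<=` closed_ball a r.
Proof.
move=> r0 y yr; rewrite closed_ballE// /closed_ball_ /= distrC.
rewrite [leLHS]/Num.Def.normr/= mx_normrE bigmax_le ?ltW// => -[i j] _ /=.
rewrite ord1 !mxE -(ler_pXn2r (n := 2)) ?nnegrE//; last exact: ltW.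
rewrite -normrX ger0_norm ?sqr_ge0//.
apply: le_trans yr; rewrite /sqdist (bigD1 j)//= lerDl.
by apply: sumr_ge0 => k _; exact: sqr_ge0.
Qed.

Lemma bump_supp_compact a (r : R) : 0 < r -> compact (bump_supp a r).
Proof.
move=> r0; apply: (subclosed_compact _ (closed_ball_compact (y := a) r0)); last first.
  exact: bump_supp_ball.
apply: (@preimage_closed _ _ (sqdist a) [set t | t <= r ^+ 2]); last exact: closed_le.
move=> y _; apply: differentiable_continuous.
exact: (smooth_differentiable (smooth_sqdist a (@openT _)) (y := y)).
Qed.

(** The squared distance to the slice where the coordinates of index at least m
vanish. *)
Definition slice_sq (m : nat) y : R := \sum_(j < n) (m <= j)%:R * y 0 j ^+ 2.

Lemma slice_sq_ge0 m y : 0 <= slice_sq m y.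
Proof. by apply: sumr_ge0 => j _; rewrite mulr_ge0// sqr_ge0. Qed.

Lemma smooth_slice_sq U m : open U -> smooth_on U (slice_sq m).
Proof.
move=> oU; apply: smooth_sum => // j.
have sj := smooth_coord j oU.
apply: (smooth_ext oU _ (smoothM oU (smooth_cst (m <= j)%:R oU) (smoothM oU sj sj))).
by move=> y _ /=; rewrite expr2.
Qed.

Lemma slice_sq_eq0 m y : (forall j : 'I_n, (m <= j)%N -> y 0 j = 0) -> slice_sq m y = 0.
Proof.
move=> y0; apply: big1 => j _; case: leqP => mj; last by rewrite mul0r.
by rewrite y0// expr0n mulr0.
Qed.

Lemma pderiv_slice_sq m k y : pderiv k (slice_sq m) y = 2 * (m <= k)%:R * y 0 k.
Proof.
have dc j : differentiable (fun z : 'rV[R]_n => z 0 j) y by exact: differentiable_coord.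
have da (a : R) : differentiable (cst a : 'rV[R]_n -> R) y by exact: differentiable_cst.
rewrite (_ : slice_sq m = \sum_(j < n) (cst (m <= j)%:R \*
    ((fun z : 'rV[R]_n => z 0 j) \* (fun z : 'rV[R]_n => z 0 j)))); last first.
  by apply/funext => z; rewrite fct_sumE.
have dcc j : differentiable ((fun z : 'rV[R]_n => z 0 j) \* (fun z : 'rV[R]_n => z 0 j)) y.
  exact: differentiableM.
rewrite pderiv_sum => [|j]; last by apply: differentiableM; [exact: da|exact: dcc].
rewrite (bigD1 k)//= big1 ?addr0 => [|j jk]; rewrite pderivM//.
  by rewrite pderiv_cst mul0r addr0 pderivM// pderiv_coord eqxx /=; ring.
rewrite pderiv_cst mul0r addr0 pderivM// pderiv_coord eq_sym (negbTE jk).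
by rewrite mulr0 mul0r addr0 mulr0.
Qed.

Lemma pderiv2_slice_sq m i k y :
  pderiv i (pderiv k (slice_sq m)) y = 2 * (m <= k)%:R * (i == k)%:R.
Proof.
have dc : differentiable (fun z : 'rV[R]_n => z 0 k) y by exact: differentiable_coord.
have da (a : R) : differentiable (cst a : 'rV[R]_n -> R) y by exact: differentiable_cst.
rewrite (_ : pderiv k (slice_sq m) = cst (2 * (m <= k)%:R) \* (fun z => z 0 k)).
  by rewrite pderivM// pderiv_cst mul0r addr0 pderiv_coord.
by apply/funext => z; rewrite pderiv_slice_sq.
Qed.

(** Where w vanishes together with its first derivatives, the derivatives of chi do
not enter the first two derivatives of the product. *)
Lemma pderiv_mul0 U (chi w : 'rV[R]_n -> R) y k : smooth_on U chi ->
  smooth_on U w -> U y -> w y = 0 -> pderiv k w y = 0 ->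
  pderiv k (chi \* w) y = 0.
Proof.
move=> sc sw Uy w0 w1; rewrite pderivM ?w0 ?w1 ?mulr0 ?addr0//.
  exact: smooth_differentiable sc Uy.
exact: smooth_differentiable sw Uy.
Qed.

Lemma pderiv2_mul0 U (chi w : 'rV[R]_n -> R) y i k : open U -> smooth_on U chi ->
  smooth_on U w -> U y -> w y = 0 -> (forall j, pderiv j w y = 0) ->
  pderiv i (pderiv k (chi \* w)) y = chi y * pderiv i (pderiv k w) y.
Proof.
move=> oU sc sw Uy w0 w1.
have E z : U z -> pderiv k (chi \* w) z =
    ((chi \* pderiv k w) \+ (pderiv k chi \* w)) z.
  by move=> Uz; rewrite pderivM//; [exact: smooth_differentiable sc Uz|
    exact: smooth_differentiable sw Uz].
have d1 := smooth_differentiable sc Uy.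
have d2 := smooth_differentiable sw Uy.
have d3 := smooth_differentiable (smooth_pderiv k sc) Uy.
have d4 := smooth_differentiable (smooth_pderiv k sw) Uy.
rewrite (near_eq_pderiv i (open_near oU Uy E)).
rewrite pderivD; [|exact: differentiableM..].
by rewrite !pderivM// w0 !w1 !mulr0 !addr0.
Qed.

End Bump.

Section Calibrated.
Context {R : realType} {n : nat} {X : topologicalType}.
Variables (S : smooth_structure R n X) (g : riemannian_metric S).
Variables (p : nat) (phi : diff_form S p).
Variables (m : nat) (M : set X).
Hypothesis M_free : phi_free m M g phi.
Implicit Types (c s : chart R n X) (y : 'rV[R]_n) (f : X -> R) (V : 'M[R]_(p, n)).

Lemma hessian_near0 f c x : atlas S c -> dom c x -> (\forall z \near x, f z = 0) ->
  hessian g f c (coord c x) = 0.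
Proof.
move=> Sc cx f0; have cy := coord_cod cx.
have nf : \forall z \near coord c x, local_expr c f z = cst 0 z.
  have cp : param c @ coord c x --> x.
    by rewrite -[X in _ --> X](coordK cx); exact: param_continuous.
  by apply: cp f0.
have nd k : \forall z \near coord c x, pderiv k (local_expr c f) z = cst 0 z.
  move/nbhs_interior: nf; apply: filterS => z nz.
  by rewrite (near_eq_pderiv k nz) pderiv_cst.
apply/matrixP => i j; rewrite !mxE (near_eq_pderiv i (nd j)) pderiv_cst big1 ?subr0//.
by move=> k _; rewrite (nbhs_singleton (nd k)) mulr0.
Qed.

Lemma traces_at_near0 (P : R -> Prop) f x : P 0 -> (\forall z \near x, f z = 0) ->
  traces_at g phi P f x.
Proof.
move=> P0 f0 c Sc cx V _.
by rewrite /trace_hessian (hessian_near0 Sc cx f0) mulmx0 mul0mx linear0.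
Qed.

Lemma trace_hessianE f c y V : trace_hessian g f c y V =
  \sum_i \sum_l \sum_k V i k * V i l * hessian g f c y k l.
Proof.
rewrite /trace_hessian /mxtrace; apply: eq_bigr => i _; rewrite mxE.
apply: eq_bigr => l _; rewrite [V^T l i]mxE [(V *m _) i l]mxE mulr_suml.
by apply: eq_bigr => k _; ring.
Qed.

Lemma slice_coord0 s x (j : 'I_n) : slice_chart S m M s -> dom s x -> M x -> (m <= j)%N ->
  coord s x 0 j = 0.
Proof. by move=> [_ sM] sx Mx mj; exact: (proj1 (sM x sx) Mx). Qed.

(** Freeness: a calibrated frame at a point of M has a component outside the
tangent space of M. *)
Lemma free_normal_gt0 s x V : slice_chart S m M s -> dom s x -> M x ->
  orth_plane g phi s (coord s x) V ->
  0 < \sum_i \sum_(l < n) (m <= l)%:R * V i l ^+ 2.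
Proof.
move=> sl sx Mx [gV wV]; have [Ss _] := sl; have cy := coord_cod sx.
have N0 : 0 <= \sum_i \sum_(l < n) (m <= l)%:R * V i l ^+ 2.
  by do 2 apply: sumr_ge0 => ? _; rewrite mulr_ge0// sqr_ge0.
rewrite lt_neqAle N0 andbT eq_sym; apply/eqP => NE; apply: M_free.
have V0 i (l : 'I_n) : (m <= l)%N -> V i l = 0.
  move=> ml; have /eqP := NE; rewrite psumr_eq0 => [/allP/(_ i)|i' _]; last first.
    by apply: sumr_ge0 => ? _; rewrite mulr_ge0// sqr_ge0.
  rewrite mem_index_enum => /(_ isT)/=; rewrite psumr_eq0 => [/allP/(_ l)|? _]; last first.
    by rewrite mulr_ge0// sqr_ge0.
  by rewrite mem_index_enum ml mul1r sqrf_eq0 => /(_ isT)/eqP.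
exists x, s, V; split=> //; first by split=> //; rewrite /simple_norm gV det1 sqrtr1.
move=> w /submxP[D wD]; exists s; first by split.
have nid : \forall z \near coord s x, transition s s z = z.
  by apply: open_near (open_cod s) cy _ => z cz; exact: paramK.
have dt := smooth_map_differentiable (smooth_transition Ss Ss) (overlap_coord sx sx).
have -> : 'J (transition s s) (coord s x) = 1%:M.
  apply/matrixP => i j; rewrite jacobianE// mxE.
  rewrite (near_eq_pderiv i (g := fun z => z 0 j)) ?pderiv_coord//.
  by apply: filterS nid => z ->.
move=> i mi; rewrite mulmx1 wD mxE big1// => k _.
by rewrite V0// mulr0.
Qed.

(** The building block of the functions that are strictly plurisubharmonic on M: it
vanishes to second order along M, and only its normal second derivatives there
are nonzero. *)
Definition slice_fun s (chi : 'rV[R]_n -> R) : X -> R :=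
  extend_by_zero s (chi \* slice_sq m).

(** At a point of M the first derivatives vanish, so neither the Christoffel symbols
nor the derivatives of chi contribute. *)
Lemma trace_slice_fun s chi x V : slice_chart S m M s -> smooth_on (cod s) chi ->
  dom s x -> M x ->
  trace_hessian g (slice_fun s chi) s (coord s x) V =
  2 * chi (coord s x) * \sum_i \sum_(l < n) (m <= l)%:R * V i l ^+ 2.
Proof.
move=> sl sc sx Mx; have cy := coord_cod sx; have oc := open_cod s.
set y := coord s x.
have y0 (j : 'I_n) : (m <= j)%N -> y 0 j = 0 by exact: slice_coord0.
have w0 : slice_sq m y = 0 by exact: slice_sq_eq0.
have w1 k : pderiv k (slice_sq m) y = 0.
  rewrite pderiv_slice_sq; case: leqP => mk; last by rewrite mulr0 mul0r.
  by rewrite y0// mulr0.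
have sw := smooth_slice_sq m oc.
have E z : cod s z -> local_expr s (slice_fun s chi) z = (chi \* slice_sq m) z.
  exact: local_extend_by_zero.
have E1 k z : cod s z -> pderiv k (local_expr s (slice_fun s chi)) z =
    pderiv k (chi \* slice_sq m) z.
  by move=> cz; apply: near_eq_pderiv; exact: open_near oc cz E.
have hE k l : hessian g (slice_fun s chi) s y k l = chi y * (2 * (m <= l)%:R * (k == l)%:R).
  rewrite mxE (near_eq_pderiv k (open_near oc cy (E1 l))).
  rewrite (pderiv2_mul0 _ _ oc sc sw cy w0 w1) pderiv2_slice_sq big1 ?subr0// => j _.
  by rewrite E1// (pderiv_mul0 sc sw cy w0 (w1 j)) mulr0.
rewrite trace_hessianE mulr_sumr; apply: eq_bigr => i _.
rewrite mulr_sumr; apply: eq_bigr => l _.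
rewrite (bigD1 l)//= big1 ?addr0 => [|k /negbTE kl]; rewrite hE.
  by rewrite eqxx mulr1 -/y; ring.
by rewrite kl !mulr0.
Qed.

End Calibrated.

(** * The cone of admissible functions *)

Section Series.
Context {R : realType}.

Lemma series_term_le (u : R^nat) k : (forall j, 0 <= u j) -> cvgn (series u) ->
  u k <= limn (series u).
Proof.
move=> u0 cu; apply: limr_ge => //; exists k.+1 => // j /= kj.
rewrite /series /= (bigD1_seq k) ?mem_index_iota ?iota_uniq//=.
by rewrite lerDl; exact: sumr_ge0.
Qed.

End Series.

Section Admissible.
Context {R : realType} {n : nat} {X : topologicalType}.
Variables (S : smooth_structure R n X) (g : riemannian_metric S).
Variables (p : nat) (phi : diff_form S p).
Variables (m : nat) (M : set X).
Hypotheses (M_submanifold : closed_submanifold S m M) (M_free : phi_free m M g phi).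
Variables (A : set X) (A_closed : closed A) (AM : A `<=` M).
Implicit Types (c s : chart R n X) (y : 'rV[R]_n) (f : X -> R) (V : 'M[R]_(p, n)).

Local Notation psh f x := (traces_at g phi (fun t => 0 <= t) f x).
Local Notation spsh f x := (traces_at g phi (fun t => 0 < t) f x).

(** The functions that satisfy all requirements of the theorem in the weak sense.
This cone is closed under the countable sums of weighted_sum, which lets the
strict requirements be met one point at a time. *)
Definition admissible f := [/\ smooth_function S f, forall x, 0 <= f x,
  forall x, A x -> f x = 0 & forall x, M x -> psh f x].

(** No cancellation can occur on M, since there every term contributes
nonnegatively to the trace; each strict inequality is inherited by the sum. *)
Lemma admissible_sum (f : nat -> X -> R) : (forall k, admissible (f k)) ->
  exists F, [/\ admissible F, forall x k, 0 < f k x -> 0 < F x &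
    forall x k, M x -> spsh (f k) x -> spsh F x].
Proof.
move=> af.
have sf k : smooth_function S (f k) by have [] := af k.
have [e [e0 [sF cF hF]]] := weighted_sum g sf.
set F := (fun x => _) in sF hF; exists F.
have f0 k x : 0 <= e k * f k x by rewrite mulr_ge0 ?(ltW (e0 k))//; have [] := af k.
have tF x : exists c, [/\ atlas S c, dom c x & forall V,
    series (fun k => e k * trace_hessian g (f k) c (coord c x) V) @ \oo -->
      trace_hessian g F c (coord c x) V].
  have [c [Sc cx hc]] := hF x; exists c; split=> // V.
  rewrite trace_hessianE.
  have -> : series (fun k => e k * trace_hessian g (f k) c (coord c x) V) =
      (fun N => \sum_i \sum_l \sum_j V i j * V i l *
        series (fun k => e k * hessian g (f k) c (coord c x) j l) N).
    apply/funext => N; rewrite /series /=.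
    under eq_bigr do rewrite trace_hessianE mulr_sumr.
    rewrite exchange_big; apply: eq_bigr => i _ /=.
    under eq_bigr do rewrite mulr_sumr.
    rewrite exchange_big; apply: eq_bigr => l _ /=.
    under eq_bigr do rewrite mulr_sumr.
    rewrite exchange_big; apply: eq_bigr => j _ /=.
    by rewrite mulr_sumr; apply: eq_bigr => k _; rewrite mulrCA.
  apply: cvg_sumr => i; apply: cvg_sumr => l; apply: cvg_sumr => j.
  by apply: cvgMl_tmp; exact: hc.
have term_le x c V k : M x -> atlas S c -> dom c x -> orth_plane g phi c (coord c x) V ->
    series (fun k => e k * trace_hessian g (f k) c (coord c x) V) @ \oo -->
      trace_hessian g F c (coord c x) V ->
    e k * trace_hessian g (f k) c (coord c x) V <= trace_hessian g F c (coord c x) V.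
  move=> Mx Sc cx oV cT; rewrite -(cvg_lim _ cT)//.
  apply: (@series_term_le _ (fun k => e k * trace_hessian g (f k) c (coord c x) V)).
    move=> j; rewrite mulr_ge0 ?(ltW (e0 j))//.
    by have [_ _ _ /(_ x Mx c Sc cx V oV)] := af j.
  exact: cvgP cT.
split.
- split=> //.
  + by move=> x; apply: le_trans (f0 0%N x) _; exact: series_term_le.
  + move=> x Ax; rewrite /F.
    have -> : (fun k => e k * f k x) = (fun=> 0).
      by apply/funext => k; have [_ _ /(_ x Ax) -> _] := af k; rewrite mulr0.
    rewrite (_ : series _ = cst 0) ?lim_cst//.
    by apply/funext => N; rewrite /series /= big1.
  + move=> x Mx; have [c [Sc cx cT]] := tF x.
    apply: (traces_at_chart Sc cx sF) => V oV.
    apply: le_trans (term_le x c V 0%N Mx Sc cx oV (cT V)).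
    rewrite mulr_ge0 ?(ltW (e0 _))//.
    by have [_ _ _ /(_ x Mx c Sc cx V oV)] := af 0%N.
- move=> x k fk; apply: lt_le_trans (_ : e k * f k x <= _); first by rewrite mulr_gt0.
  by apply: (@series_term_le _ (fun k => e k * f k x)).
- move=> x k Mx fk; have [c [Sc cx cT]] := tF x.
  apply: (traces_at_chart Sc cx sF) => V oV.
  apply: lt_le_trans (term_le x c V k Mx Sc cx oV (cT V)).
  by rewrite mulr_gt0//; exact: fk.
Qed.

Lemma admissible0 : admissible (fun=> 0).
Proof.
split=> //; first exact: smooth_function_cst.
by move=> x _; apply: traces_at_near0 => //; exact: nearW.
Qed.

Lemma chart_ball c x (O : set X) : dom c x -> open O -> O x ->
  exists2 r, 0 < r & closed_ball (coord c x) r `<=` cod c `&` param c @^-1` O.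
Proof.
move=> cx oO Ox; have cy := coord_cod cx.
have cp : param c @ coord c x --> param c (coord c x) := param_continuous cy.
have nO : nbhs (coord c x) (cod c `&` param c @^-1` O).
  apply: filterI; first by apply: open_nbhs_nbhs; split=> //; exact: cod_open.
  by apply: cp; rewrite coordK//; exact: open_nbhs_nbhs.
move/nbhs_ballP: nO => [r /= r0 rO]; exists (r / 2); first by rewrite divr_gt0.
apply: subset_trans rO; apply: closed_ball_subset; first by rewrite divr_gt0.
by rewrite ltr_pdivrMr// ltr_pMr// ltr1n.
Qed.

Definition bump_fun c (a : 'rV[R]_n) r : X -> R := extend_by_zero c (bump a r).

Section BumpFun.
Variables (c : chart R n X) (a : 'rV[R]_n) (r : R) (O : set X).
Hypotheses (Sc : atlas S c) (r0 : 0 < r)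
  (rO : closed_ball a r `<=` cod c `&` param c @^-1` O).

Let suppc : bump_supp a r `<=` cod c.
Proof. by move=> y /(bump_supp_ball r0)/rO[]. Qed.

Lemma smooth_extend_bump (w : 'rV[R]_n -> R) : smooth_on (cod c) w ->
  smooth_function S (extend_by_zero c (bump a r \* w)).
Proof.
move=> sw; have oc := open_cod c.
apply: (extend_by_zero_smooth (K := bump_supp a r) Sc) => //.
- exact: (smoothM oc (smooth_bump a r oc) sw).
- exact: bump_supp_compact.
- by move=> y _ /bump_eq0 y0 /=; rewrite y0 mul0r.
Qed.

Lemma smooth_bump_fun : smooth_function S (bump_fun c a r).
Proof.
have oc := open_cod c.
apply: (extend_by_zero_smooth (K := bump_supp a r) Sc) => //.
- exact: smooth_bump.
- exact: bump_supp_compact.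
- by move=> y _ /bump_eq0.
Qed.

Lemma bump_fun_ge0 x : 0 <= bump_fun c a r x.
Proof. by rewrite /bump_fun /extend_by_zero; case: ifP => // _; exact: bump_ge0. Qed.

Lemma bump_fun_eq0 x : ~ O x -> bump_fun c a r x = 0.
Proof.
move=> nOx; rewrite /bump_fun /extend_by_zero; case: asboolP => // cx.
apply: bump_eq0 => /(bump_supp_ball r0)/rO[_] /=.
by rewrite coordK.
Qed.

Lemma bump_fun_near0 x : ~ (param c @` bump_supp a r) x ->
  \forall z \near x, bump_fun c a r z = 0.
Proof.
move=> nx; have clK := param_compact_closed S (bump_supp_compact (a := a) r0) suppc.
have nK : nbhs x (~` (param c @` bump_supp a r)).
  by apply: open_nbhs_nbhs; split=> //; exact: closed_openC.
apply: filterS nK => z nz; rewrite /bump_fun /extend_by_zero; case: asboolP => // cz.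
apply: bump_eq0 => Kz; apply: nz; exists (coord c z) => //; exact: coordK.
Qed.

End BumpFun.

(** The model functions are admissible, and strict where the bump is positive. *)
Lemma slice_fun_admissible s a r : slice_chart S m M s -> 0 < r ->
  closed_ball a r `<=` cod s ->
  admissible (slice_fun m s (bump a r)) /\
  forall x, M x -> dom s x -> 0 < bump a r (coord s x) ->
    spsh (slice_fun m s (bump a r)) x.
Proof.
move=> sl r0 rs; have [Ss _] := sl; have os := open_cod s.
have rs' : closed_ball a r `<=` cod s `&` param s @^-1` setT by move=> y /rs.
have sf : smooth_function S (slice_fun m s (bump a r)).
  exact: (smooth_extend_bump Ss r0 rs' (smooth_slice_sq m os)).
have sb := smooth_bump a r os.
have strict x : M x -> dom s x -> 0 < bump a r (coord s x) ->
    spsh (slice_fun m s (bump a r)) x.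
  move=> Mx sx b0; apply: (traces_at_chart Ss sx sf) => V oV.
  rewrite (trace_slice_fun g V sl sb sx Mx) mulr_gt0 ?mulr_gt0//.
  exact: (free_normal_gt0 M_free sl sx Mx oV).
split=> //; split=> //.
- move=> x; rewrite /slice_fun /extend_by_zero; case: ifP => // _ /=.
  by rewrite mulr_ge0 ?bump_ge0 ?slice_sq_ge0.
- move=> x /AM Mx; rewrite /slice_fun /extend_by_zero; case: asboolP => // sx /=.
  by rewrite slice_sq_eq0 ?mulr0// => j; exact: (slice_coord0 sl sx Mx).
- move=> x Mx; have [sx|nsx] := pselect (dom s x).
    apply: (traces_at_chart Ss sx sf) => V oV.
    rewrite (trace_slice_fun g V sl sb sx Mx) mulr_ge0 ?mulr_ge0 ?bump_ge0//.
    exact: ltW (free_normal_gt0 M_free sl sx Mx oV).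
  apply: traces_at_near0 => //.
  have nx : ~ (param s @` bump_supp a r) x.
    by move=> [y /(bump_supp_ball r0)/rs/param_dom sy yx]; apply: nsx; rewrite -yx.
  apply: filterS (bump_fun_near0 r0 rs' nx) => z.
  rewrite /bump_fun /slice_fun /extend_by_zero; case: asboolP => //= _ ->.
  by rewrite mul0r.
Qed.

Lemma admissible_strict x : M x -> exists2 f, admissible f & spsh f x.
Proof.
move=> Mx; have [_ _ /(_ x Mx)[s sl sx]] := M_submanifold.
have [r r0 rs] := closed_ball_cod (coord_cod sx).
have [af strict] := slice_fun_admissible sl r0 rs.
by exists (slice_fun m s (bump (coord s x) r)) => //; apply: strict => //; exact: bump_center.
Qed.

Lemma admissible_pos_off x : ~ M x -> exists2 f, admissible f & 0 < f x.
Proof.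
move=> nMx; have [c Sc cx] := atlas_cover S x.
have [_ clM _] := M_submanifold.
have oM : open (~` M) by exact: closed_openC.
have [r r0 rO] := chart_ball cx oM nMx.
exists (bump_fun c (coord c x) r); last first.
  by rewrite /bump_fun extend_by_zeroE//; exact: bump_center.
split=> //; first exact: (smooth_bump_fun Sc r0 rO).
- exact: bump_fun_ge0.
- by move=> z /AM Mz; apply: (bump_fun_eq0 r0 rO) => /(_ Mz).
- move=> z Mz; apply: traces_at_near0 => //.
  apply: (bump_fun_near0 r0 rO) => -[y /(bump_supp_ball r0)/rO[_ /= nMy] yz].
  by apply: nMy; rewrite yz.
Qed.

(** At a point of M outside A, a bump supported away from A is compensated by a
large multiple of the model function of a slice chart, which is strict on the
compact trace on M of the support of the bump. *)
Lemma admissible_pos_on x : M x -> ~ A x -> exists2 f, admissible f & 0 < f x.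
Proof.
move=> Mx nAx; have [_ _ /(_ x Mx)[s sl sx]] := M_submanifold.
have [Ss sM] := sl.
have oA : open (~` A) by exact: closed_openC.
have [r r0 rO] := chart_ball sx oA nAx.
set a := coord s x in rO.
have rs : closed_ball a r `<=` cod s by move=> y /rO[].
have [af2 strict] := slice_fun_admissible sl r0 rs.
set f2 := slice_fun m s (bump a r) in af2 strict.
have r20 : 0 < r / 2 by rewrite divr_gt0.
have rO2 : closed_ball a (r / 2) `<=` cod s `&` param s @^-1` (~` A).
  apply: subset_trans rO; move=> y; rewrite !closed_ballE// /closed_ball_ /=.
  by move=> /le_trans; apply; rewrite ler_pdivrMr// ler_pMr// ler1n.
pose f1 := bump_fun s a (r / 2).
have sf1 : smooth_function S f1 by exact: (smooth_bump_fun Ss r20 rO2).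
have [sf2 f20 f2A f2psh] := af2.
(* The part of the support of f1 that lies on M, read in the slice chart. *)
pose K := bump_supp a (r / 2) `&` [set y | forall j : 'I_n, (m <= j)%N -> y 0 j = 0].
have Ks : K `<=` cod s by move=> y [/(bump_supp_ball r20)/rO2[]].
have cK : compact K.
  apply: compact_closedI; first exact: bump_supp_compact.
  suff : closed (\bigcap_(j in [set j : 'I_n | (m <= j)%N]) [set y : 'rV[R]_n | y 0 j = 0]).
    by congr closed; apply/seteqP; split=> y /= H j; exact: H.
  apply: closed_bigI => j _.
  apply: (@preimage_closed _ _ (fun y : 'rV[R]_n => y 0 j) [set 0]); last exact: closed_eq.
  by move=> y _; exact: entry_continuous.
have KM y : K y -> M (param s y).
  move=> Ky; have cy := Ks _ Ky; apply/(sM _ (param_dom cy)).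
  by rewrite paramK//; case: Ky.
have Kpos y : K y -> 0 < bump a r y.
  move=> [ya _]; apply: bump_gt0; apply: le_lt_trans ya _.
  by rewrite ltr_pXn2r ?nnegrE ?(ltW r0) ?(ltW r20)// ltr_pdivrMr// ltr_pMr// ltr1n.
have cP : compact (planes_over g phi s K) by exact: planes_over_compact.
have [| |d d0 dP] := @compact_lower_bound R _ (planes_over g phi s K)
    (fun t => trace_hessian g f2 s t.1 t.2) cP.
- by move=> z [Kz _]; exact: (trace_hessian_continuous Ss sf2 (Ks _ Kz)).
- move=> [y V] [/= Ky oV]; have cy := Ks _ Ky.
  have := strict _ (KM y Ky) (param_dom cy); rewrite paramK// => /(_ (Kpos y Ky)).
  by move=> /(_ s Ss (param_dom cy) V); rewrite paramK//; exact.
have [|C C0 CP] := @compact_abs_bound R _ (planes_over g phi s K)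
    (fun t => trace_hessian g f1 s t.1 t.2) cP.
  by move=> z [Kz _]; exact: (trace_hessian_continuous Ss sf1 (Ks _ Kz)).
(* Over K the trace of f1 is at least - C and that of f2 at least d. *)
pose L := C / d.
have L0 : 0 <= L by rewrite divr_ge0// ltW.
have sf : smooth_function S (fun z => f1 z + L * f2 z) by exact: smooth_function_lin.
exists (fun z => f1 z + L * f2 z); last first.
  apply: ltr_wpDr; first by rewrite mulr_ge0.
  by rewrite /f1 /bump_fun extend_by_zeroE//; exact: bump_center.
split; first exact: sf.
- by move=> z; apply: addr_ge0; [exact: bump_fun_ge0|exact: mulr_ge0].
- move=> z Az; rewrite f2A// mulr0 addr0.
  by apply: (bump_fun_eq0 r20 rO2) => /(_ Az).
- move=> z Mz; have [[y Ky0 yz]|nz] := pselect ((param s @` bump_supp a (r / 2)) z).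
    have cy : cod s y by move: Ky0 => /(bump_supp_ball r20)/rO2[].
    have sz : dom s z by rewrite -yz; exact: param_dom.
    have Ky : K y.
      split=> // j mj; have := slice_coord0 sl sz Mz mj.
      by rewrite -yz paramK.
    apply: (traces_at_chart Ss sz sf) => V; rewrite -yz paramK// => oV.
    rewrite trace_hessian_lin//.
    have := dP (y, V) (conj Ky oV); have := CP (y, V) (conj Ky oV) => /=.
    rewrite ler_norml => /andP[tC _] td.
    have : L * d <= L * trace_hessian g f2 s y V by rewrite ler_wpM2l.
    rewrite /L divfK ?gt_eqF// => H.
    move: tC H; move: (trace_hessian g f1 s y V) (C / d * _) => t1 t2; lra.
  move=> c Sc cz V oV; rewrite trace_hessian_lin//; last exact: coord_cod.
  have f1near := bump_fun_near0 r20 rO2 nz.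
  rewrite /trace_hessian (hessian_near0 g Sc cz f1near) mulmx0 mul0mx linear0 add0r.
  by rewrite mulr_ge0//; exact: f2psh.
Qed.

End Admissible.

Theorem proposition7p7 (R : realType) (n : nat) (X : topologicalType)
    (S : smooth_structure R n X) (g : riemannian_metric S)
    (p : nat) (phi : diff_form S p) (p_ge1 : (1 <= p)%N)
    (phi_calibration : calibration g phi)
    (m : nat) (M : set X) (M_submanifold : closed_submanifold S m M)
    (M_free : phi_free m M g phi)
    (A : set X) (A_closed : closed A) (AM : A `<=` M) :
  exists f : X -> R,
    [/\ smooth_function S f,
        forall x, 0 <= f x,
        A = [set x | f x = 0],
        forall x, M x -> strictly_psh_at g phi f x &
        exists U : set X, [/\ open U, M `<=` U &
          forall x, U x -> strictly_psh_at g phi f x]].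
Proof.
have sc : @second_countable X := manifold_second_countable S.
have a0 := admissible0 g phi M A.
have [x nAx|e1 [ae1 e1P]] := lindelof (P := admissible g phi M A)
    (D := ~` A) (Q := fun f x => 0 < f x) sc a0.
  have [f af fx] : exists2 f, admissible g phi M A f & 0 < f x.
    have [Mx|nMx] := pselect (M x); last exact: (admissible_pos_off g phi M_submanifold AM nMx).
    exact: (admissible_pos_on M_submanifold M_free A_closed AM Mx nAx).
  exists f => //; have [sf _ _ _] := af.
  have cf : f @ x --> f x by exact: smooth_function_continuous sf x.
  have : nbhs x (f @^-1` [set t | 0 < t]) by apply: cf; exact: lt_nbhsr.
  by apply: filterS => z fz _.
have [x Mx|e2 [ae2 e2P]] := lindelof (P := admissible g phi M A)
    (D := M) (Q := fun f x => traces_at g phi (fun t => 0 < t) f x) sc a0.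
  have [f af fx] := admissible_strict M_submanifold M_free AM Mx.
  exists f => //; have [sf _ _ _] := af.
  by apply: filterS (traces_gt0_open sf fx) => z fz _.
have [F1 [[sF1 F1ge F1A F1psh] F1pos _]] := admissible_sum ae1.
have [F2 [[sF2 F2ge F2A F2psh] _ F2strict]] := admissible_sum ae2.
pose F x := F1 x + 1 * F2 x.
have sF : smooth_function S F by exact: smooth_function_lin.
have Fstrict x : M x -> traces_at g phi (fun t => 0 < t) F x.
  move=> Mx c Sc cx V oV; rewrite (trace_hessian_lin g 1 V sF1 sF2 Sc (coord_cod cx)) mul1r.
  have [k e2k] := e2P x Mx.
  rewrite ltr_wpDl//; first exact: F1psh oV.
  by have := F2strict x k Mx e2k c Sc cx V oV.
have psh_of x : traces_at g phi (fun t => 0 < t) F x -> strictly_psh_at g phi F x.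
  exact: (strictly_psh_traces p_ge1 phi_calibration sF).
exists F; split=> //.
- by move=> x; rewrite /F mul1r addr_ge0.
- apply/seteqP; split=> [x Ax|x /= Fx]; first by rewrite /= /F F1A// F2A// mulr0 addr0.
  apply: contrapT => nAx; have [k e1k] := e1P x nAx.
  have := F1pos x k e1k; have := F2ge x; move: Fx; rewrite /F; lra.
- by move=> x /Fstrict/psh_of.
- exists (interior [set x | strictly_psh_at g phi F x]); split.
  + exact: open_interior.
  + move=> x /Fstrict Fx; have := traces_gt0_open sF Fx.
    by apply: filterS => z; exact: psh_of.
  + by move=> x; exact: interior_subset.
Qed.
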